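(* Let $\mathcal B$ be a Baer subplane of $\mathrm{PG}(2,q^2)$ tangent to $\ell_\infty$ at the point $\bar T=\mathcal B\cap\ell_\infty$, and let $\bar P\in\ell_\infty$, $\bar P\neq\bar T$. Every $\ell_\infty$-Baer pencil with vertex $\bar P$ meets $\mathcal B$ either (i) in a non-degenerate conic of $\mathcal B$ through $\bar T$, or (ii) in the union of two lines of $\mathcal B$, namely the unique line of $\mathcal B$ whose extension to a line of $\mathrm{PG}(2,q^2)$ contains $\bar P$, and one line of $\mathcal B$ through $\bar T$. Among the $\ell_\infty$-Baer pencils with vertex $\bar P$, exactly $q^2-1$ are of type (i) and exactly $q+1$ are of type (ii), the latter containing respectively the $q+1$ distinct lines of $\mathcal B$ through $\bar T$.
   Context: A Baer subplane of $\mathrm{PG}(2,q^2)$ is a subplane of order $q$; it is tangent to $\ell_\infty$ if it meets $\ell_\infty$ in exactly one point. A line of $\mathcal B$ means a Baer subline $m\cap\mathcal B$ with $|m\cap\mathcal B|=q+1$. A Baer pencil in $\mathrm{PG}(2,q^2)$ is the union of the $q+1$ lines joining a vertex point $P$ to the points of a Baer subline $b$ (the base) not through $P$. An $\ell_\infty$-Baer pencil is a Baer pencil whose vertex lies on $\ell_\infty$ and whose base meets $\ell_\infty$ in a point; it contains $\ell_\infty$ and $q^3$ affine points. *)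

(* Defs.v *)
From HB Require Import structures.
From mathcomp Require Import all_boot all_order all_algebra all_field.
Set Implicit Arguments. Unset Strict Implicit. Unset Printing Implicit Defensive.
Import Order.TTheory GRing.Theory.
Local Open Scope ring_scope.

Section PG2.
Variable F : finFieldType.

(* canonical (normalised) homogeneous coordinates: first nonzero entry is 1 *)
Definition normalized (v : 'rV[F]_3) : bool :=
  [exists i : 'I_3, (v 0 i == 1) && [forall j : 'I_3, (j < i)%N ==> (v 0 j == 0)]].

(* points of PG(2,F); lines are represented by the same type (dual coordinates) *)
Definition point : finType := {v : 'rV[F]_3 | normalized v}.
Definition line : finType := {v : 'rV[F]_3 | normalized v}.

Definition on (X : point) (l : line) : bool := (val X *m (val l)^T) 0 0 == 0.
Definition pts (l : line) : {set point} := [set X | on X l].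

Definition represents (X : point) (v : 'rV[F]_3) : bool :=
  (v != 0) && [exists c : F, (c != 0) && (val X == c *: v)].

Definition collinear (X Y Z : point) : bool :=
  [exists l : line, [&& on X l, on Y l & on Z l]].

Definition subplane_of_order (n : nat) (B : {set point}) : Prop :=
  [/\ exists X1 X2 X3 X4,
        [/\ [&& X1 \in B, X2 \in B, X3 \in B & X4 \in B],
            ~~ collinear X1 X2 X3, ~~ collinear X1 X2 X4,
            ~~ collinear X1 X3 X4 & ~~ collinear X2 X3 X4],
      (forall l m : line, l != m -> (2 <= #|pts l :&: B|)%N ->
          (2 <= #|pts m :&: B|)%N -> forall X, on X l -> on X m -> X \in B) &
      (forall l : line, (2 <= #|pts l :&: B|)%N -> #|pts l :&: B| = n.+1)].

Definition baer_subplane (q : nat) (B : {set point}) : Prop :=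
  subplane_of_order q B.

Definition line_of (q : nat) (B : {set point}) (m : line) : bool :=
  #|pts m :&: B| == q.+1.

Definition inK (q : nat) (x : F) : bool := x ^+ q == x.
Definition Kvec (q : nat) (w : 'rV[F]_3) : bool := [forall i, inK q (w 0 i)].

(* Baer subline: image of PG(1,q): { <x a + y c> : (x,y) in GF(q)^2 \ 0 }, a, c independent *)
Definition baer_subline (q : nat) (b : {set point}) : bool :=
  [exists a : 'rV[F]_3, exists c : 'rV[F]_3,
     (\rank (col_mx a c) == 2%N) &&
     (b == [set X | [exists x : F, exists y : F,
              [&& inK q x, inK q y, (x, y) != (0, 0) & represents X (x *: a + y *: c)]]])].

Definition pencil (P : point) (b : {set point}) : {set point} :=
  [set Z | [exists X in b, exists l : line, [&& on P l, on X l & on Z l]]].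

Definition linf_baer_pencil (q : nat) (linf : line) (P : point) (Pi : {set point}) : bool :=
  [exists b : {set point},
     [&& baer_subline q b, P \notin b, on P linf,
         #|b :&: pts linf| == 1%N & Pi == pencil P b]].

Definition qform (a b c f g h : F) (w : 'rV[F]_3) : F :=
  a * w 0 0 ^+ 2 + b * w 0 1 ^+ 2 + c * w 0 2 ^+ 2
  + f * w 0 1 * w 0 2 + g * w 0 2 * w 0 0 + h * w 0 0 * w 0 1.

(* non-singularity (valid in every characteristic) *)
Definition qform_nondeg (a b c f g h : F) : bool :=
  4%:R * a * b * c + f * g * h - a * f ^+ 2 - b * g ^+ 2 - c * h ^+ 2 != 0.

Definition baer_frame (q : nat) (M : 'M[F]_3) (B : {set point}) : bool :=
  (M \in unitmx) &&
  (B == [set X | [exists w : 'rV[F]_3, [&& w != 0, Kvec q w & represents X (w *m M)]]]).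

Definition conic_of (q : nat) (B C : {set point}) : bool :=
  [exists M : 'M[F]_3, baer_frame q M B &&
   [exists a : F, exists b : F, exists c : F, exists f : F, exists g : F, exists h : F,
     [&& [forall x in [:: a; b; c; f; g; h], inK q x], qform_nondeg a b c f g h &
         C == [set X | [exists w : 'rV[F]_3,
                 [&& w != 0, Kvec q w, qform a b c f g h w == 0 & represents X (w *m M)]]]]]].

Definition typeI (q : nat) (B : {set point}) (T : point) (Pi : {set point}) : bool :=
  conic_of q B (Pi :&: B) && (T \in Pi :&: B).

Definition typeII_with (q : nat) (B : {set point}) (P : point) (n : line) (Pi : {set point}) : bool :=
  [exists m : line, [&& line_of q B m, on P m & Pi :&: B == (pts m :|: pts n) :&: B]].

Definition typeII (q : nat) (B : {set point}) (P T : point) (Pi : {set point}) : bool :=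
  [exists n : line, [&& line_of q B n, on T n & typeII_with q B P n Pi]].

End PG2.

(* Main.v *)
(** In suitable homogeneous coordinates, [B] is PG(2,K) with K = GF(q),
    [T] = (0,0,1) and [P] = (1,w,0) with w outside K.  Lines through [P] are the
    values of (u : z) with u = y - w x, and the l_inf-Baer pencils with vertex [P]
    are the loci Tr(g z u^q) = c N(u) with g <> 0 and c in K, the pair (g,c) being
    unique up to K*.  On [B], where z is in K, this reads z L(x,y) = c N(x,y) with
    L(x,y) = Tr(g u^q) K-linear and N(x,y) = u^(q+1) anisotropic: for c <> 0 it is a
    conic of discriminant c N(g) (w - w^q)^2, for c = 0 it is the line z = 0
    together with the line L = 0 through [T].  Normalising c = 1 leaves q^2 - 1
    values of g; for c = 0 the classes of g modulo K* are represented by 1 and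
    w + k with k in K. *)
Require Import Defs.
From HB Require Import structures.
From mathcomp Require Import all_boot all_order all_algebra all_field.
From mathcomp Require Import ring.
Set Implicit Arguments. Unset Strict Implicit. Unset Printing Implicit Defensive.
Import GRing.Theory.
Local Open Scope ring_scope.

(** * Points and lines in a frame *)

(** A subplane is given synthetically (a quadrangle, closure under meets of its lines, q+1 points
    per line), so a frame over GF(q) has to be constructed. Once a quadrangle is moved to the
    standard one, the coordinates of the points of [B] on an axis form a set of q elements closed
    under products, and a count identifies it with the roots of X^q = X.

    The shape (1, w, 0) of the vertex comes from splitting its coordinates over K as p0 + w p1;
    tangency is what makes p0, p1 and [T] independent.

    A point lies on a pencil exactly when two expressions A, D, one for each base vector, are
    dependent over K, that is, A D^q = A^q D. This is the source of the Hermitian equation.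

    Exact counts also require the two types to exclude each other. A conic of [B] may be presented
    in any frame and in any characteristic, so exclusion rests on the discriminant: a form with
    nonzero discriminant vanishes on no 2-dimensional subspace. *)

Section Points.
Variable F : finFieldType.
Implicit Types (v w n : 'rV[F]_3) (X Y Z : point F) (l : line F).

Definition row3 (x y z : F) : 'rV[F]_3 := \row_i [:: x; y; z]`_i.

Lemma row3E0 x y z : row3 x y z 0 0 = x. Proof. by rewrite mxE. Qed.
Lemma row3E1 x y z : row3 x y z 0 1 = y. Proof. by rewrite mxE. Qed.
Lemma row3E2 x y z : row3 x y z 0 2 = z. Proof. by rewrite mxE. Qed.
Definition row3E := (row3E0, row3E1, row3E2).

Lemma ord3P (Q : 'I_3 -> Prop) : Q 0 -> Q 1 -> Q 2 -> forall i, Q i.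
Proof.
move=> Q0 Q1 Q2 [[|[|[|//]]] lti].
- by rewrite (_ : Ordinal lti = 0) //; apply: val_inj.
- by rewrite (_ : Ordinal lti = 1) //; apply: val_inj.
- by rewrite (_ : Ordinal lti = 2) //; apply: val_inj.
Qed.

Lemma row3_surj v : exists x y z, v = row3 x y z.
Proof.
by exists (v 0 0), (v 0 1), (v 0 2); apply/rowP; apply: ord3P; rewrite row3E.
Qed.

Lemma row3_eq0 x y z : (row3 x y z == 0) = [&& x == 0, y == 0 & z == 0].
Proof.
apply/eqP/and3P=> [/rowP e|[/eqP-> /eqP-> /eqP->]].
  by move: (e 0) (e 1) (e 2); rewrite !row3E !mxE => -> -> ->.
by apply/rowP; apply: ord3P; rewrite row3E mxE.
Qed.

Lemma row3_lin a b x y z x' y' z' :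
  a *: row3 x y z + b *: row3 x' y' z' =
  row3 (a * x + b * x') (a * y + b * y') (a * z + b * z').
Proof. by apply/rowP; apply: ord3P; rewrite !mxE. Qed.

Lemma row3Z a x y z : a *: row3 x y z = row3 (a * x) (a * y) (a * z).
Proof. by apply/rowP; apply: ord3P; rewrite !mxE. Qed.

Lemma row3_inj x y z x' y' z' :
  row3 x y z = row3 x' y' z' -> [/\ x = x', y = y' & z = z'].
Proof.
by move/rowP=> e; move: (e 0) (e 1) (e 2); rewrite !row3E.
Qed.

Lemma big_ord3 (f : 'I_3 -> F) : \sum_i f i = f 0 + f 1 + f 2.
Proof.
rewrite !big_ord_recl big_ord0 addr0 addrA.
by congr (f _ + f _ + f _); apply: val_inj.
Qed.

Lemma row3_dot x y z a b c :
  (row3 x y z *m (row3 a b c)^T) 0 0 = x * a + y * b + z * c.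
Proof. by rewrite mxE big_ord3 ![_^T _ _]mxE !row3E. Qed.

Lemma point_neq0 X : val X != 0.
Proof.
case: X => v /= /existsP[i /andP[/eqP vi _]].
by apply: contra_eq_neq vi => ->; rewrite mxE eq_sym oner_eq0.
Qed.

Lemma normalized_delta : normalized (delta_mx 0 0 : 'rV[F]_3).
Proof.
apply/existsP; exists 0; rewrite mxE !eqxx /=.
by apply/forallP=> j.
Qed.

Lemma represents_ex v : v != 0 -> exists X, represents X v.
Proof.
move=> v0; have /existsP[i0 vi0] : [exists i, v 0 i != 0].
  apply: contraR v0; rewrite negb_exists => /forallP h.
  by apply/eqP/rowP=> i; rewrite mxE; apply/eqP; rewrite -[_ == _]negbK.
case: (@arg_minnP _ i0 (fun i => v 0 i != 0) (fun i : 'I_3 => i) vi0) => i vi hmin.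
have nv : normalized ((v 0 i)^-1 *: v).
  apply/existsP; exists i; rewrite mxE mulVf // eqxx /=.
  apply/forallP=> j; apply/implyP=> ltji; rewrite mxE mulf_eq0; apply/orP; right.
  by apply: contraLR ltji => /hmin; rewrite -leqNgt.
exists (Sub _ nv : point F); rewrite /represents v0 /=.
by apply/existsP; exists (v 0 i)^-1; rewrite invr_eq0 vi /= eqxx.
Qed.

Lemma represents_inj X Y v : represents X v -> represents Y v -> X = Y.
Proof.
case: X Y => x nx [y ny] /andP[_ /existsP[c /andP[c0 /eqP /= ex]]].
case/andP=> _ /existsP[d /andP[d0 /eqP /= ey]]; apply: val_inj => /=.
case/existsP: (nx) => i /andP[/eqP xi /forallP hi].
case/existsP: (ny) => j /andP[/eqP yj /forallP hj].
have vx k : (x 0 k == 0) = (v 0 k == 0) by rewrite ex mxE mulf_eq0 (negPf c0).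
have vy k : (y 0 k == 0) = (v 0 k == 0) by rewrite ey mxE mulf_eq0 (negPf d0).
have ij : i = j.
  case: (ltngtP i j) => [lt|lt|]; last exact: val_inj.
    by move: (hj i); rewrite lt vy -vx xi oner_eq0.
  by move: (hi j); rewrite lt vx -vy yj oner_eq0.
have vi : v 0 i != 0 by rewrite -vx xi oner_neq0.
by rewrite -{j hj}ij in yj; move: xi yj; rewrite ex ey !mxE => <- /(mulIf vi) ->.
Qed.

(** The zero row represents no point and gets the default (1,0,0); hence the conditions [v != 0]
    below. *)
Definition mkpt v : point F :=
  odflt (Sub _ normalized_delta) [pick X | represents X v].

Lemma mkptP v : v != 0 -> represents (mkpt v) v.
Proof.
move=> /represents_ex[X hX]; rewrite /mkpt.
by case: pickP => [//|/(_ X)]; rewrite hX.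
Qed.

Lemma representsE X v : represents X v = (v != 0) && (X == mkpt v).
Proof.
apply/idP/andP=> [h|[v0 /eqP->]]; last exact: mkptP.
have v0 : v != 0 by case/andP: h.
by split=> //; apply/eqP/(represents_inj h)/mkptP.
Qed.

Lemma mkpt_val X : mkpt (val X) = X.
Proof.
apply/eqP; rewrite eq_sym; suff : represents X (val X) by rewrite representsE => /andP[].
by rewrite /represents point_neq0; apply/existsP; exists 1; rewrite oner_eq0 scale1r /=.
Qed.

Lemma val_mkpt v : v != 0 -> exists2 c, c != 0 & val (mkpt v) = c *: v.
Proof.
by move=> /mkptP/andP[_ /existsP[c /andP[c0 /eqP e]]]; exists c.
Qed.

Lemma mkptZ c v : c != 0 -> v != 0 -> mkpt (c *: v) = mkpt v.
Proof.
move=> c0 v0; apply/esym/eqP.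
suff : represents (mkpt v) (c *: v) by rewrite representsE => /andP[].
case: (val_mkpt v0) => d d0 e; rewrite /represents scaler_eq0 negb_or c0 v0.
apply/existsP; exists (d / c); rewrite mulf_neq0 ?invr_eq0 //= e scalerA.
by rewrite mulfVK.
Qed.

Lemma mkpt_eq v w : v != 0 -> w != 0 -> mkpt v = mkpt w -> exists2 c, c != 0 & v = c *: w.
Proof.
move=> v0 w0 e; case: (val_mkpt v0) => c c0; rewrite e.
case: (val_mkpt w0) => d d0 -> /(congr1 ( *:%R c^-1)).
rewrite !scalerA mulVf // scale1r => <-.
by exists (c^-1 * d); rewrite ?mulf_neq0 ?invr_eq0.
Qed.

Lemma on_mkpt v n : v != 0 -> n != 0 ->
  on (mkpt v) (mkpt n) = ((v *m n^T) 0 0 == 0).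
Proof.
move=> /val_mkpt[c c0 ev] /val_mkpt[d d0 en].
rewrite /on ev [val _]en linearZ /= -scalemxAl -scalemxAr !mxE !mulf_eq0.
by rewrite (negPf c0) (negPf d0).
Qed.

End Points.

Section Frame.
Variables (F : finFieldType) (M : 'M[F]_3).
Hypothesis uM : M \in unitmx.

Definition pt3 x y z : point F := mkpt (row3 x y z *m M).
(** Dual coordinates transform by the inverse transpose, so that incidence in the frame is again the
    plain dot product. *)
Definition ln3 x y z : line F := mkpt (row3 x y z *m (invmx M)^T).

Lemma mulmxM_eq0 (v : 'rV_3) : (v *m M == 0) = (v == 0).
Proof.
apply/eqP/eqP=> [/(congr1 (mulmx^~ (invmx M)))|->]; last by rewrite mul0mx.
by rewrite /= mulmxK // mul0mx.
Qed.

Lemma mulmxVT_eq0 (v : 'rV_3) : (v *m (invmx M)^T == 0) = (v == 0).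
Proof.
apply/eqP/eqP=> [/(congr1 (mulmx^~ M^T))|->]; last by rewrite mul0mx.
by rewrite /= -mulmxA -trmx_mul mulmxV // trmx1 mulmx1 mul0mx.
Qed.

Lemma on_frame x y z a b c : row3 x y z != 0 -> row3 a b c != 0 ->
  on (pt3 x y z) (ln3 a b c) = (x * a + y * b + z * c == 0).
Proof.
move=> v0 n0; rewrite on_mkpt ?mulmxM_eq0 ?mulmxVT_eq0 //.
by rewrite trmx_mul trmxK -mulmxA (mulmxA M) mulmxV // mul1mx row3_dot.
Qed.

Lemma pt3_surj X : exists x y z, row3 x y z != 0 /\ X = pt3 x y z.
Proof.
have [x [y [z e]]] := row3_surj (val X *m invmx M).
exists x, y, z; rewrite /pt3 -e mulmxKV // mkpt_val; split=> //.
by rewrite -mulmxM_eq0 mulmxKV // point_neq0.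
Qed.

Lemma ln3_surj (l : line F) : exists a b c, row3 a b c != 0 /\ l = ln3 a b c.
Proof.
have [a [b [c e]]] := row3_surj (val l *m M^T).
exists a, b, c; rewrite /ln3 -e -mulmxA -trmx_mul mulVmx // trmx1 mulmx1 mkpt_val.
split=> //; rewrite -mulmxVT_eq0 -mulmxA -trmx_mul mulVmx // trmx1 mulmx1.
exact: point_neq0.
Qed.

Lemma pt3_eq x y z x' y' z' : row3 x y z != 0 -> row3 x' y' z' != 0 ->
  pt3 x y z = pt3 x' y' z' ->
  exists c, [/\ c != 0, x = c * x', y = c * y' & z = c * z'].
Proof.
move=> v0 w0 /mkpt_eq[]; rewrite ?mulmxM_eq0 // => c c0.
rewrite scalemxAl => /(congr1 (mulmx^~ (invmx M))); rewrite /= !mulmxK //.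
by rewrite row3Z => /row3_inj[-> -> ->]; exists c.
Qed.

Lemma pt3Z c x y z : c != 0 -> row3 x y z != 0 -> pt3 (c * x) (c * y) (c * z) = pt3 x y z.
Proof.
by move=> c0 v0; rewrite /pt3 -row3Z -scalemxAl mkptZ // mulmxM_eq0.
Qed.

End Frame.

(** * The Frobenius map of GF(q^2) over GF(q) *)

Section Frobenius.
Variables (F : finFieldType) (q : nat).
Hypothesis cardF : #|F| = (q ^ 2)%N.

Definition cj (x : F) := x ^+ q.

Lemma order_gt1 : (1 < q)%N.
Proof.
have := finNzRing_gt1 F; rewrite cardF.
by case: q => [|[|]].
Qed.

(** Since q^2 is the order of a finite field, q is a power of the characteristic; this makes x ->
    x^q additive. *)
Lemma pchar_nat_order : [pchar F].-nat q.
Proof.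
have [p pp pF] := finPcharP F.
rewrite (eq_pnat _ (pcharf_eq pF)); have := card_pprimeChar pF.
rewrite cardF => e; have : p.-nat (q ^ 2)%N by rewrite e pnatX pnat_id.
by rewrite pnatX orbF.
Qed.

Lemma cjD x y : cj (x + y) = cj x + cj y.
Proof. exact/exprDn_pchar/pchar_nat_order. Qed.
Lemma cjN x : cj (- x) = - cj x.
Proof. exact/exprNn_pchar/pchar_nat_order. Qed.
Lemma cjM x y : cj (x * y) = cj x * cj y.
Proof. exact: exprMn. Qed.
Lemma cjV x : cj x^-1 = (cj x)^-1.
Proof. exact: exprVn. Qed.
Lemma cjK x : cj (cj x) = x.
Proof. by rewrite /cj -exprM mulnn -cardF expf_card. Qed.
Lemma cj0 : cj 0 = 0.
Proof. by rewrite /cj expr0n gtn_eqF // ltnW // order_gt1. Qed.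
Lemma cj1 : cj 1 = 1.
Proof. exact: expr1n. Qed.
Lemma cj_eq0 x : (cj x == 0) = (x == 0).
Proof. by rewrite expf_eq0 ltnW // order_gt1. Qed.

Lemma inKE x : inK q x = (cj x == x). Proof. by []. Qed.
Lemma inKP x : inK q x -> cj x = x. Proof. by move/eqP. Qed.

Definition subK := [set x : F | inK q x].

(** A degree bound on X^q - X. Equality comes later, in [card_subK], from counting points of [B] on
    a line. *)
Lemma card_subK_le : (#|subK| <= q)%N.
Proof.
have sz : size ('X^q - 'X : {poly F}) = q.+1.
  rewrite size_polyDl ?size_polyXn // size_polyN size_polyX ltnS.
  exact: order_gt1.
rewrite cardE -ltnS -sz max_poly_roots ?enum_uniq //.
  by rewrite -size_poly_gt0 sz.
apply/allP=> x; rewrite mem_enum inE => /eqP ex.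
by rewrite /root !hornerE ex subrr.
Qed.

(* A finite set of nonzero elements closed under multiplication is a group, so x^(q-1) = 1. *)
Lemma mul_closed_subK (S : {set F}) : #|S| = q -> 0 \in S ->
  {in S &, forall x y, x * y \in S} -> S = subK.
Proof.
move=> cS S0 SM; apply/eqP; rewrite eqEcard cS card_subK_le andbT.
apply/subsetP=> x xS; rewrite inE /inK.
have [->|x0] := eqVneq x 0; first by rewrite expr0n gtn_eqF // ltnW // order_gt1.
pose S' := S :\ 0; have e : [set x * y | y in S'] = S'.
  apply/eqP; rewrite eqEcard card_imset ?leqnn; last exact: mulfI.
  rewrite andbT; apply/subsetP=> _ /imsetP[y /setD1P[y0 yS] ->].
  by rewrite !inE mulf_neq0 ?SM.
have cS' : #|S'| = q.-1 by move: (cardsD1 0 S); rewrite S0 cS => ->.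
have p0 : \prod_(y in S') y != 0 by apply/prodf_neq0=> y /setD1P[].
have : \prod_(y in S') y = x ^+ q.-1 * \prod_(y in S') y.
  rewrite -{1}e big_imset /=; last by move=> y z _ _; apply: mulfI.
  by rewrite big_split /= prodr_const cS'.
rewrite -{1}[\prod_(y in S') y]mul1r => /(mulIf p0) x1.
by rewrite -(prednK (ltnW order_gt1)) exprS -x1 mulr1.
Qed.

End Frobenius.

(** * Coordinates for a subplane of order q *)

Section FrameMatrices.
Variable F : finFieldType.
Implicit Types (M : 'M[F]_3) (X Y Z : point F) (l : line F) (B : {set point F}).

Definition mx3 (u v w : 'rV[F]_3) : 'M[F]_3 :=
  \matrix_(i, j) row3 (u 0 j) (v 0 j) (w 0 j) 0 i.

Lemma row3_mx3 a b c u v w : row3 a b c *m mx3 u v w = a *: u + b *: v + c *: w.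
Proof. by apply/rowP=> j; rewrite mxE big_ord3 ![mx3 _ _ _ _ _]mxE !row3E !mxE. Qed.

Lemma unitmx_inj M : (forall v : 'rV_3, v *m M = 0 -> v = 0) -> M \in unitmx.
Proof.
move=> h; rewrite unitmxE unitfE; apply/negP=> /det0P[v v0 /h e].
by rewrite e eqxx in v0.
Qed.

(** A nonzero vector in the right kernel of the matrix is the dual vector of a line through all
    three points. *)
Lemma noncollinear_unitmx X Y Z : ~~ collinear X Y Z -> mx3 (val X) (val Y) (val Z) \in unitmx.
Proof.
rewrite -unitmx_tr unitmxE unitfE; apply: contra => /det0P[n n0].
have [a [b [c en]]] := row3_surj n.
move/(congr1 trmx); rewrite trmx_mul trmxK trmx0 => e.
have onl u v w i : row3 u v w *m mx3 (val X) (val Y) (val Z) = val i -> on i (mkpt n).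
  move=> ei; rewrite -(mkpt_val i) on_mkpt ?point_neq0 // -ei -mulmxA e mulmx0.
  by rewrite mxE.
apply/existsP; exists (mkpt n); apply/and3P; split.
- by apply: (onl 1 0 0); rewrite row3_mx3 !scale0r scale1r !addr0.
- by apply: (onl 0 1 0); rewrite row3_mx3 !scale0r scale1r !addr0 add0r.
- by apply: (onl 0 0 1); rewrite row3_mx3 !scale0r scale1r !add0r.
Qed.

(** Distinctness is certified by a line (a, b, c) through the first point only; [ln3_neq] is the
    dual certificate. *)
Lemma pt3_neq M (uM : M \in unitmx) x y z x' y' z' a b c :
  row3 x y z != 0 -> row3 x' y' z' != 0 -> row3 a b c != 0 ->
  x * a + y * b + z * c = 0 -> x' * a + y' * b + z' * c != 0 ->
  pt3 M x y z != pt3 M x' y' z'.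
Proof.
move=> v0 w0 n0 e; apply: contra => /eqP eP.
by rewrite -(on_frame uM w0 n0) -eP (on_frame uM) // e.
Qed.

Lemma ln3_neq M (uM : M \in unitmx) x y z a b c a' b' c' :
  row3 x y z != 0 -> row3 a b c != 0 -> row3 a' b' c' != 0 ->
  x * a + y * b + z * c = 0 -> x * a' + y * b' + z * c' != 0 ->
  ln3 M a b c != ln3 M a' b' c'.
Proof.
move=> v0 w0 n0 e; apply: contra => /eqP eP.
by rewrite -(on_frame uM v0 n0) -eP (on_frame uM) // e.
Qed.

Lemma KvecP q (w : 'rV[F]_3) :
  reflect [/\ inK q (w 0 0), inK q (w 0 1) & inK q (w 0 2)] (Kvec q w).
Proof.
apply: (iffP forallP) => [h|[h0 h1 h2]]; first by split.
exact: ord3P.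
Qed.

Lemma Kvec_row3 q x y z : Kvec q (row3 x y z : 'rV[F]_3) = [&& inK q x, inK q y & inK q z].
Proof. by apply/KvecP/and3P; rewrite !row3E. Qed.

Lemma represents_frame M X x y z : M \in unitmx ->
  represents X (row3 x y z *m M) = (row3 x y z != 0) && (X == pt3 M x y z).
Proof. by move=> uM; rewrite representsE mulmxM_eq0. Qed.

Lemma baer_frameP q M B : baer_frame q M B <->
  M \in unitmx /\ forall X, X \in B <->
    exists x y z, [/\ inK q x, inK q y, inK q z, row3 x y z != 0 & X = pt3 M x y z].
Proof.
have E X : M \in unitmx -> [exists w : 'rV[F]_3, [&& w != 0, Kvec q w & represents X (w *m M)]] <->
    exists x y z, [/\ inK q x, inK q y, inK q z, row3 x y z != 0 & X = pt3 M x y z].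
  move=> uM; split=> [/existsP[w]|[x [y [z [kx ky kz v0 ->]]]]].
    have [x [y [z ->]]] := row3_surj w; rewrite represents_frame // Kvec_row3.
    by case/and3P=> v0 /and3P[kx ky kz] /andP[_ /eqP->]; exists x, y, z.
  apply/existsP; exists (row3 x y z); rewrite represents_frame // Kvec_row3.
  by rewrite v0 kx ky kz eqxx.
split=> [/andP[uM /eqP eB]|[uM h]].
  by split=> // X; rewrite {1}eB inE; apply: E.
rewrite /baer_frame uM; apply/eqP/setP=> X; rewrite inE.
by apply/idP/idP=> [/h/E|/E/h]; apply.
Qed.

End FrameMatrices.

Ltac simp01 := rewrite ?(mul0r, mulr0, add0r, addr0, mulr1, mul1r, mulrN1, mulrN).
Ltac nz := simp01; rewrite ?row3_eq0 ?(oner_eq0, oppr_eq0, eqxx, andbF, andbT).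

(** * Coordinatisation of a subplane from a quadrangle *)

Section Coordinates.
Variables (F : finFieldType) (q : nat) (B : {set point F}).
Hypothesis cardF : #|F| = (q ^ 2)%N.
Hypothesis subB : baer_subplane q B.

Definition rich (l : line F) := (2 <= #|pts l :&: B|)%N.

Lemma rich2 X Y l : X \in B -> Y \in B -> X != Y -> on X l -> on Y l -> rich l.
Proof.
move=> XB YB XY Xl Yl; rewrite /rich; have <- : #|[set X; Y]| = 2%N by rewrite cards2 XY.
by apply/subset_leq_card/subsetP=> Z; rewrite !inE => /orP[]/eqP->; apply/andP.
Qed.

Lemma rich_meet X l m : rich l -> rich m -> l != m -> on X l -> on X m -> X \in B.
Proof. by case: subB => _ h _ rl rm lm; apply: h rl rm X. Qed.

Lemma rich_card l : rich l -> #|pts l :&: B| = q.+1.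
Proof. by case: subB => _ _; apply. Qed.

Lemma quadrangle_frame : exists2 M, M \in unitmx &
  [/\ pt3 M 1 0 0 \in B, pt3 M 0 1 0 \in B, pt3 M 0 0 1 \in B & pt3 M 1 1 1 \in B].
Proof.
case: subB => -[X1 [X2 [X3 [X4 [/and4P[B1 B2 B3 B4] n123 n124 n134 n234]]]]] _ _.
pose N := mx3 (val X1) (val X2) (val X3).
have uN : N \in unitmx by apply: noncollinear_unitmx.
have e1 : X1 = pt3 N 1 0 0 by rewrite /pt3 row3_mx3 !scale0r scale1r !addr0 mkpt_val.
have e2 : X2 = pt3 N 0 1 0 by rewrite /pt3 row3_mx3 !scale0r scale1r addr0 add0r mkpt_val.
have e3 : X3 = pt3 N 0 0 1 by rewrite /pt3 row3_mx3 !scale0r scale1r !add0r mkpt_val.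
have [a [b [c [v0 e4]]]] := pt3_surj uN X4.
(* A vanishing coordinate would put [X4] on a side of the triangle [X1], [X2], [X3]. *)
have a0 : a != 0.
  apply: contra n234 => /eqP a0; apply/existsP; exists (ln3 N 1 0 0).
  rewrite e2 e3 e4 !(on_frame uN) //; try by nz.
  by rewrite a0 !(mul0r, mulr0, addr0) eqxx.
have b0 : b != 0.
  apply: contra n134 => /eqP b0; apply/existsP; exists (ln3 N 0 1 0).
  rewrite e1 e3 e4 !(on_frame uN) //; try by nz.
  by rewrite b0 !(mul0r, mulr0, addr0) eqxx.
have c0 : c != 0.
  apply: contra n124 => /eqP c0; apply/existsP; exists (ln3 N 0 0 1).
  rewrite e1 e2 e4 !(on_frame uN) //; try by nz.
  by rewrite c0 !(mul0r, mulr0, addr0) eqxx.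
(* Scaling the basis vectors by the coordinates of [X4] turns [X4] into (1,1,1) and fixes the other
   three points. *)
pose M := mx3 (a *: val X1) (b *: val X2) (c *: val X3).
have eM x y z : row3 x y z *m M = row3 (x * a) (y * b) (z * c) *m N.
  by rewrite !row3_mx3 !scalerA.
have uM : M \in unitmx.
  apply: unitmx_inj => v; have [x [y [z ->]]] := row3_surj v; rewrite eM.
  move/eqP; rewrite (mulmxM_eq0 uN) row3_eq0 !mulf_eq0 (negPf a0) (negPf b0) (negPf c0) !orbF.
  by rewrite -row3_eq0 => /eqP.
exists M => //; rewrite /pt3 !eM !(mul0r, mul1r).
rewrite (_ : row3 a 0 0 = a *: row3 1 0 0); last by rewrite row3Z mulr0 mulr1.
rewrite (_ : row3 0 b 0 = b *: row3 0 1 0); last by rewrite row3Z mulr0 mulr1.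
rewrite (_ : row3 0 0 c = c *: row3 0 0 1); last by rewrite row3Z mulr0 mulr1.
rewrite -!scalemxAl !mkptZ ?(mulmxM_eq0 uN) //; try by nz.
by rewrite -![mkpt _]/(pt3 N _ _ _) -e1 -e2 -e3 -e4.
Qed.

Section FixedFrame.
Variable M : 'M[F]_3.
Hypothesis uM : M \in unitmx.
Hypothesis Bx : pt3 M 1 0 0 \in B.
Hypothesis By : pt3 M 0 1 0 \in B.
Hypothesis Bz : pt3 M 0 0 1 \in B.
Hypothesis B1 : pt3 M 1 1 1 \in B.

Lemma rich3 x y z x' y' z' a b c : pt3 M x y z \in B -> pt3 M x' y' z' \in B ->
  row3 x y z != 0 -> row3 x' y' z' != 0 -> row3 a b c != 0 ->
  pt3 M x y z != pt3 M x' y' z' ->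
  x * a + y * b + z * c = 0 -> x' * a + y' * b + z' * c = 0 -> rich (ln3 M a b c).
Proof.
move=> X1 X2 v0 w0 n0 ne e1 e2.
by apply: rich2 X1 X2 ne _ _; rewrite (on_frame uM) // ?e1 ?e2.
Qed.

Lemma meet3 x y z a b c a' b' c' : rich (ln3 M a b c) -> rich (ln3 M a' b' c') ->
  row3 x y z != 0 -> row3 a b c != 0 -> row3 a' b' c' != 0 ->
  ln3 M a b c != ln3 M a' b' c' ->
  x * a + y * b + z * c = 0 -> x * a' + y * b' + z * c' = 0 -> pt3 M x y z \in B.
Proof.
move=> r1 r2 v0 n0 n0' ne e1 e2.
by apply: rich_meet r1 r2 ne _ _; rewrite (on_frame uM) // ?e1 ?e2.
Qed.

Ltac nq a b c := apply: (pt3_neq uM (a := a) (b := b) (c := c)); try (by nz); try ring.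
Ltac nl x y z := apply: (ln3_neq uM (x := x) (y := y) (z := z)); try (by nz); try ring.

Lemma rich_y0 : rich (ln3 M 0 1 0).
Proof. by apply: (rich3 Bx Bz); try (by nz); try ring; nq (0 : F) (0 : F) (1 : F). Qed.

Lemma rich_z0 : rich (ln3 M 0 0 1).
Proof. by apply: (rich3 Bx By); try (by nz); try ring; nq (0 : F) (1 : F) (0 : F). Qed.

Lemma rich_xy : rich (ln3 M 1 (-1) 0).
Proof. by apply: (rich3 Bz B1); try (by nz); try ring; nq (1 : F) (0 : F) (0 : F). Qed.

Lemma rich_vertical x y : pt3 M x y 1 \in B -> rich (ln3 M 1 0 (- x)).
Proof. by move=> h; apply: (rich3 By h); try (by nz); try ring; nq (0 : F) (0 : F) (1 : F). Qed.

Lemma rich_horizontal x y : pt3 M x y 1 \in B -> rich (ln3 M 0 1 (- y)).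
Proof. by move=> h; apply: (rich3 Bx h); try (by nz); try ring; nq (0 : F) (0 : F) (1 : F). Qed.

Lemma rich_slope x y z : pt3 M x y z \in B -> x != 0 -> rich (ln3 M y (- x) 0).
Proof.
move=> h x0; have v0 : row3 x y z != 0 by rewrite row3_eq0 (negPf x0).
apply: (rich3 Bz h) => //; try (by nz); try ring; last by nq (1 : F) (0 : F) (0 : F).
by rewrite row3_eq0 oppr_eq0 (negPf x0) andbF.
Qed.

(** The coordinatising set of [B] in the manner of von Staudt, read on the axis y = 0; it turns out
    to be GF(q). *)
Definition scoord := [set s : F | pt3 M s 0 1 \in B].

(** Verticals project to the axis y = 0, and the diagonal x = y, a line of [B] through (0,0,1) and
    (1,1,1), exchanges the two coordinates. Conversely (x, y, 1) is the meet of a vertical and a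
    horizontal line of [B]. *)
Lemma affine_scoord x y : (pt3 M x y 1 \in B) = (x \in scoord) && (y \in scoord).
Proof.
have xp a b : pt3 M a b 1 \in B -> a \in scoord.
  move=> /rich_vertical r; rewrite inE.
  by apply: (meet3 r rich_y0); try (by nz); try ring; nl (0 : F) (1 : F) (0 : F).
have diag a b : pt3 M a b 1 \in B -> pt3 M b b 1 \in B.
  move=> /rich_horizontal r.
  by apply: (meet3 r rich_xy); try (by nz); try ring; nl (1 : F) (0 : F) (0 : F).
have diag' a : pt3 M a 0 1 \in B -> pt3 M a a 1 \in B.
  move=> /rich_vertical r.
  by apply: (meet3 r rich_xy); try (by nz); try ring; nl (0 : F) (1 : F) (0 : F).
apply/idP/andP=> [h|[]]; first by split; [apply: xp h | apply: xp (diag _ _ h)].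
rewrite !inE => /rich_vertical rx /diag'/rich_horizontal ry.
by apply: (meet3 rx ry); try (by nz); try ring; nl (0 : F) (1 : F) (0 : F).
Qed.

Lemma scoord0 : 0 \in scoord. Proof. by rewrite inE. Qed.
Lemma scoord1 : 1 \in scoord.
Proof. by move: B1; rewrite affine_scoord => /andP[]. Qed.

(** The line y = m x joins (0,0,1) to (1,m,1), and it meets the vertical x = s in (s, s m, 1). *)
Lemma scoordM : {in scoord &, forall x y, x * y \in scoord}.
Proof.
move=> s m hs hm; have h1 : pt3 M 1 m 1 \in B by rewrite affine_scoord scoord1.
have rm := rich_slope h1 (oner_neq0 F).
have hs' : pt3 M s 0 1 \in B by rewrite inE in hs.
suff : pt3 M s (s * m) 1 \in B by rewrite affine_scoord => /andP[].
by apply: (meet3 (rich_vertical hs') rm); try (by nz); try ring; nl (0 : F) (1 : F) (0 : F).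
Qed.

Lemma card_scoord : #|scoord| = q.
Proof.
apply/eq_add_S; rewrite -(rich_card rich_y0).
have v1 (s : F) : row3 s 0 1 != 0 by nz.
have v2 : row3 (1 : F) 0 0 != 0 by nz.
have n0 : row3 (0 : F) 1 0 != 0 by nz.
(* Of the q+1 points of [B] on y = 0 exactly one, (1,0,0), has z = 0; the other q are the affine
   ones. *)
have -> : pts (ln3 M 0 1 0) :&: B = pt3 M 1 0 0 |: [set pt3 M s 0 1 | s in scoord].
  apply/setP=> X; rewrite !in_setU !inE.
  apply/andP/orP=> [[]|[/eqP->|/imsetP[s hs ->]]].
  - have [x [y [z [v0 ->]]]] := pt3_surj uM X; rewrite (on_frame uM) //.
    simp01 => /eqP y0 XB; rewrite y0 in v0 XB *.
    have [z0|z0] := eqVneq z 0.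
      left; rewrite z0 in v0 *; have x0 : x != 0 by move: v0; rewrite row3_eq0 eqxx !andbT.
      by rewrite -(pt3Z uM x0 v2) mulr1 mulr0.
    right; have e : pt3 M x 0 z = pt3 M (x / z) 0 1.
      by rewrite -(pt3Z uM z0 (v1 _)) mulr0 mulr1 mulrCA mulfV // mulr1.
    by apply/imsetP; exists (x / z); rewrite // inE -e.
  - by rewrite (on_frame uM) //; simp01.
  - by rewrite (on_frame uM) //; simp01; rewrite inE in hs.
rewrite cardsU1 card_in_imset => [|s t _ _ /(pt3_eq uM (v1 _) (v1 _))[c [_ -> _ ec]]].
  suff -> : pt3 M 1 0 0 \notin [set pt3 M s 0 1 | s in scoord] by [].
  apply/imsetP=> -[s _ /(pt3_eq uM v2 (v1 _))[c [c0 _ _ /eqP]]].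
  by rewrite mulr1 eq_sym (negPf c0).
by move: ec; rewrite mulr1 => <-; rewrite mul1r.
Qed.

Lemma scoord_subK : scoord = subK F q.
Proof. exact: mul_closed_subK card_scoord scoord0 scoordM. Qed.

Lemma pt3_baer x y z : row3 x y z != 0 -> (pt3 M x y z \in B) <->
  exists c, [/\ c != 0, inK q (c * x), inK q (c * y) & inK q (c * z)].
Proof.
have inS a : (a \in scoord) = inK q a by rewrite scoord_subK inE.
(* A point with z = 0 is tested through the line y = m x, which joins it to the affine point (1, m,
   1). *)
have slope m : (pt3 M 1 m 0 \in B) = inK q m.
  rewrite -inS; apply/idP/idP=> h.
    have r : rich (ln3 M m (-1) 0) by apply: rich_slope h (oner_neq0 F).
    suff : pt3 M 1 m 1 \in B by rewrite affine_scoord => /andP[].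
    by apply: (meet3 (rich_vertical B1) r); try (by nz); try ring; nl (0 : F) (1 : F) (0 : F).
  have h1 : pt3 M 1 m 1 \in B by rewrite affine_scoord scoord1.
  have r : rich (ln3 M m (-1) 0) by apply: rich_slope h1 (oner_neq0 F).
  by apply: (meet3 rich_z0 r); try (by nz); try ring; nl (0 : F) (1 : F) (0 : F).
have kV (a : F) : inK q a -> inK q a^-1 by move/inKP=> e; rewrite inKE cjV e.
have kM (a b : F) : inK q a -> inK q b -> inK q (a * b).
  by move=> /inKP ea /inKP eb; rewrite inKE cjM ea eb.
have k1 : inK q (1 : F) by rewrite inKE cj1.
have k0 : inK q (0 : F) by rewrite inKE (cj0 cardF).
move=> v0; have [z0|z0] := eqVneq z 0; last first.
  rewrite -(pt3Z uM (invr_neq0 z0) v0) mulVf // affine_scoord !inS.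
  split=> [/andP[h1 h2]|[c [c0 h1 h2 h3]]].
    by exists z^-1; rewrite invr_eq0 mulVf.
  have e a : z^-1 * a = (c * a) * (c * z)^-1 by field; rewrite c0 z0.
  by rewrite !e; apply/andP; split; apply: kM => //; apply: kV.
have [x0|x0] := eqVneq x 0.
  have y0 : y != 0 by move: v0; rewrite row3_eq0 x0 z0 eqxx andbT.
  rewrite -(pt3Z uM (invr_neq0 y0) v0) mulVf // z0 x0 !mulr0; split=> // _.
  by exists y^-1; rewrite !mulr0 mulVf // invr_eq0.
rewrite -(pt3Z uM (invr_neq0 x0) v0) mulVf // z0 !mulr0 slope.
split=> [h|[c [c0 h1 h2 h3]]].
  by exists x^-1; rewrite invr_eq0 mulVf // mulr0.
have -> : x^-1 * y = (c * y) * (c * x)^-1 by field; rewrite c0 x0.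
by apply: kM => //; apply: kV.
Qed.

Lemma quadrangle_baer_frame : baer_frame q M B.
Proof.
apply/baer_frameP; split=> // X; split=> [XB|[x [y [z [kx ky kz v0 ->]]]]].
  have [x [y [z [v0 eX]]]] := pt3_surj uM X; rewrite eX in XB *.
  case/(pt3_baer v0): XB => c [c0 kx ky kz].
  exists (c * x), (c * y), (c * z); rewrite (pt3Z uM c0 v0) -row3Z scaler_eq0.
  by rewrite negb_or c0.
by apply/(pt3_baer v0); exists 1; rewrite oner_neq0 !mul1r.
Qed.

End FixedFrame.

Lemma baer_subplane_frame : exists M, baer_frame q M B.
Proof.
have [M uM [h1 h2 h3 h4]] := quadrangle_frame.
by exists M; apply: quadrangle_baer_frame.
Qed.

Lemma card_subK : #|subK F q| = q.
Proof.
have [M uM [h1 h2 h3 h4]] := quadrangle_frame.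
by rewrite -(@scoord_subK M) // card_scoord.
Qed.

End Coordinates.

(** * A frame adapted to the vertex and the point at infinity *)

Section Lines.
Variable F : finFieldType.

Lemma rank2P (a d : 'rV[F]_3) : reflect
  (forall x y, x *: a + y *: d = 0 -> x = 0 /\ y = 0) (\rank (col_mx a d) == 2%N).
Proof.
apply: (iffP idP) => [r x y e|h].
  have /row_free_inj f : row_free (col_mx a d) by [].
  have /f : row_mx x%:M y%:M *m col_mx a d = (0 : 'rV_(1 + 1)) *m col_mx a d.
    by rewrite mul_row_col !mul_scalar_mx e mul0mx.
  by rewrite -row_mx0 => /eq_row_mx[/rowP/(_ 0)+ /rowP/(_ 0)]; rewrite !mxE.
apply: (@inj_row_free _ (1 + 1)) => v; rewrite -[v]hsubmxK mul_row_col.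
rewrite [lsubmx v]mx11_scalar [rsubmx v]mx11_scalar !mul_scalar_mx => /h[-> ->].
by rewrite raddf0 row_mx0.
Qed.

(** Both dual vectors lie in the kernel of the rank 2 matrix formed by the two points, and this
    kernel has dimension 1. *)
Lemma line_uniq (X Y : point F) (l m : line F) :
  X != Y -> on X l -> on Y l -> on X m -> on Y m -> l = m.
Proof.
move=> XY Xl Yl Xm Ym; pose A := col_mx (val X) (val Y).
have rA : \rank A = 2%N.
  apply/eqP/rank2P=> x y /eqP; rewrite addr_eq0 -scaleNr => /eqP e.
  have [x0|x0] := eqVneq x 0.
    move/esym/eqP: e; rewrite x0 scale0r scaler_eq0 (negPf (point_neq0 Y)) orbF oppr_eq0.
    by move/eqP.
  case/negP: XY; apply/eqP; rewrite -(mkpt_val X) -(mkptZ x0 (point_neq0 X)) e.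
  rewrite mkptZ ?mkpt_val ?point_neq0 //; apply: contra_eq_neq e => ->.
  by rewrite scale0r scaler_eq0 negb_or x0 point_neq0.
have inker (k : line F) : on X k -> on Y k -> (val k <= kermx A^T)%MS.
  move=> Xk Yk; apply/sub_kermxP; rewrite /A tr_col_mx mul_mx_row -(row_mx0 _ 1 1 1).
  congr row_mx; apply: trmx_inj; rewrite trmx_mul trmxK trmx0 [LHS]mx11_scalar.
    by rewrite (eqP Xk) raddf0.
  by rewrite (eqP Yk) raddf0.
have rk : \rank (kermx A^T) = 1%N by rewrite mxrank_ker mxrank_tr rA.
have kerl : (kermx A^T <= val l)%MS.
  by have/mxrank_leqif_sup<- := inker l Xl Yl; rewrite rk rank_rV point_neq0.
have /sub_rVP[c ec] := submx_trans (inker m Xm Ym) kerl.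
have c0 : c != 0.
  by apply: contraNneq (point_neq0 m) => c0; rewrite ec c0 scale0r.
by rewrite -(mkpt_val m) ec mkptZ ?mkpt_val ?point_neq0.
Qed.
End Lines.

Section NormalFrame.
Variables (F : finFieldType) (q : nat).
Hypothesis cardF : #|F| = (q ^ 2)%N.

Lemma inKD (x y : F) : inK q x -> inK q y -> inK q (x + y).
Proof. by rewrite !inKE (cjD cardF) => /eqP-> /eqP->. Qed.
Lemma inKN (x : F) : inK q (- x) = inK q x.
Proof. by rewrite !inKE (cjN cardF) eqr_opp. Qed.
Lemma inKM (x y : F) : inK q x -> inK q y -> inK q (x * y).
Proof. by rewrite !inKE cjM => /eqP-> /eqP->. Qed.
Lemma inKV (x : F) : inK q x^-1 = inK q x.
Proof. by rewrite !inKE cjV (inj_eq invr_inj). Qed.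
Lemma inK0 : inK q (0 : F).
Proof. by rewrite inKE (cj0 cardF). Qed.
Lemma inK1 : inK q (1 : F).
Proof. by rewrite inKE cj1. Qed.

Lemma notinK_ex : exists w : F, ~~ inK q w.
Proof.
have h := card_subK_le cardF; apply/existsP; rewrite -negb_forall.
apply: contraTN h => /forallP h; rewrite -ltnNge.
have -> : subK F q = setT by apply/setP=> x; rewrite !inE h.
have q1 := order_gt1 cardF.
by rewrite cardsT cardF -mulnn -{1}[q]mul1n ltn_mul2r q1 (ltnW q1).
Qed.

Lemma subcj_neq0 (w : F) : ~~ inK q w -> w - cj q w != 0.
Proof. by rewrite inKE subr_eq0 eq_sym. Qed.

Lemma decompose_over_K (w : F) : ~~ inK q w -> forall a,
  exists x y, [/\ inK q x, inK q y & a = x + w * y].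
Proof.
(* Subtracting the conjugate of a = x + w y eliminates x in K and leaves this value of y. *)
move=> /subcj_neq0 w0 a; pose y := (a - cj q a) / (w - cj q w).
have w0' : cj q w - w != 0 by rewrite -opprB oppr_eq0.
have cd (x z : F) : cj q (x - z) = cj q x - cj q z by rewrite (cjD cardF) (cjN cardF).
exists (a - w * y), y; split; last by ring.
  rewrite inKE cd cjM /y cjM cjV !cd !(cjK cardF); apply/eqP; field.
  by rewrite w0 w0'.
rewrite inKE /y cjM cjV !cd !(cjK cardF); apply/eqP; field.
by rewrite w0 w0'.
Qed.

Definition Kmx (N : 'M[F]_3) := [forall i, Kvec q (row i N)].

Lemma Kvec_mulmx (v : 'rV[F]_3) N : Kvec q v -> Kmx N -> Kvec q (v *m N).
Proof.
move=> /forallP hv /forallP hN; apply/forallP=> j; rewrite mxE big_ord3.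
have hN' i : inK q (N i j) by move: (forallP (hN i) j); rewrite mxE.
by rewrite !inKD ?inKM.
Qed.

(** The entrywise q-th power of [v] has the same product with [N] as [v]; cancelling [N] shows that
    [v] is fixed. *)
Lemma Kvec_invmx (v : 'rV[F]_3) N : N \in unitmx -> Kvec q (v *m N) -> Kmx N -> Kvec q v.
Proof.
move=> uN /forallP hv /forallP hN.
suff /rowP e : map_mx (cj q) v = v by apply/forallP=> i; rewrite inKE -{2}e mxE.
apply: (can_inj (mulmxK uN)); apply/rowP=> j; rewrite -[RHS](inKP (hv j)) !mxE !big_ord3.
have hN' i : cj q (N i j) = N i j by apply: inKP; move: (forallP (hN i) j); rewrite mxE.
by rewrite !(cjD cardF) !cjM !hN' !mxE.
Qed.

Lemma Kmx_mx3 u v w : Kvec q u -> Kvec q v -> Kvec q w -> Kmx (mx3 u v w).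
Proof.
move=> /forallP hu /forallP hv /forallP hw; apply/forallP.
by apply: (@ord3P (fun i => Kvec q (row i _))); apply/forallP=> j; rewrite !mxE ?hu ?hv ?hw.
Qed.

Lemma baer_frame_mul (B : {set point F}) M N :
  baer_frame q M B -> N \in unitmx -> Kmx N -> baer_frame q (N *m M) B.
Proof.
move=> /andP[uM /eqP->] uN KN; rewrite /baer_frame unitmx_mul uN uM /=.
apply/eqP/setP=> X; rewrite !inE; apply/existsP/existsP=> -[w /and3P[w0 Kw rX]].
  exists (w *m invmx N); rewrite mulmxA mulmxKV // rX andbT.
  rewrite -(mulmxM_eq0 uN) mulmxKV // w0.
  by apply: (Kvec_invmx uN) KN; rewrite mulmxKV.
by exists (w *m N); rewrite -mulmxA rX (mulmxM_eq0 uN) w0 Kvec_mulmx.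
Qed.

Variables (linf : line F) (B : {set point F}) (T P : point F).
Hypotheses (subB : baer_subplane q B) (Binf : B :&: pts linf = [set T]).
Hypotheses (Plinf : on P linf) (PT : P != T).

(** The new basis is p0, p1, t, where P = p0 + w p1 over K and t is a K-vector of [T]. If it were
    dependent, some line would contain all three vectors, hence [P] and [T], so it would be
    [linf]. *)
Lemma normal_frame : exists M w, [/\ baer_frame q M B, ~~ inK q w,
  P = pt3 M 1 w 0, T = pt3 M 0 0 1 & linf = ln3 M w (-1) 0].
Proof.
have [M0 fM0] := baer_subplane_frame cardF subB.
have [uM0 BM0] := (baer_frameP q M0 B).1 fM0.
have [w wK] := notinK_ex.
have [TB Tlinf] : T \in B /\ on T linf.
  by move: (set11 T); rewrite -Binf !inE => /andP[].
have [a [b [c [p0 eP]]]] := pt3_surj uM0 P.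
have [a0 [a1 [Ka0 Ka1 ea]]] := decompose_over_K wK a.
have [b0 [b1 [Kb0 Kb1 eb]]] := decompose_over_K wK b.
have [c0 [c1 [Kc0 Kc1 ec]]] := decompose_over_K wK c.
have [t0 [t1 [t2 [Kt0 Kt1 Kt2 tn0 eT]]]] := (BM0 T).1 TB.
pose N := mx3 (row3 a0 b0 c0) (row3 a1 b1 c1) (row3 t0 t1 t2).
have KN : Kmx N by apply: Kmx_mx3; rewrite Kvec_row3; apply/and3P.
have uN : N \in unitmx.
  rewrite -unitmx_tr; apply: unitmx_inj => v; have [n0 [n1 [n2 ->]]] := row3_surj v.
  move=> /(congr1 trmx); rewrite trmx_mul trmxK trmx0 => e.
  apply/eqP/negPn/negP=> nn0.
  have dot x y z : row3 x y z *m N *m (row3 n0 n1 n2)^T = 0 by rewrite -mulmxA e mulmx0.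
  have d0 : a0 * n0 + b0 * n1 + c0 * n2 = 0.
    by move: (dot 1 0 0); rewrite row3_mx3 !scale0r scale1r !addr0 => /matrixP/(_ 0 0); rewrite row3_dot mxE.
  have d1 : a1 * n0 + b1 * n1 + c1 * n2 = 0.
    by move: (dot 0 1 0); rewrite row3_mx3 !scale0r scale1r addr0 add0r => /matrixP/(_ 0 0); rewrite row3_dot mxE.
  have d2 : t0 * n0 + t1 * n1 + t2 * n2 = 0.
    by move: (dot 0 0 1); rewrite row3_mx3 !scale0r scale1r !add0r => /matrixP/(_ 0 0); rewrite row3_dot mxE.
  have el : linf = ln3 M0 n0 n1 n2.
    apply: (line_uniq PT Plinf Tlinf).
      rewrite eP on_frame // ea eb ec; apply/eqP.
      transitivity ((a0 * n0 + b0 * n1 + c0 * n2) + w * (a1 * n0 + b1 * n1 + c1 * n2)); first by ring.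
      by rewrite d0 d1 mulr0 addr0.
    by rewrite eT on_frame // d2.
  (* Tangency enters here: a nonzero K-vector on [linf] is a point of [B] there, hence [T]. So p0
     and p1 are multiples of t, which forces P = T. *)
  have multT x y z : inK q x -> inK q y -> inK q z -> x * n0 + y * n1 + z * n2 = 0 ->
      exists k, row3 x y z = k *: row3 t0 t1 t2.
    move=> Kx Ky Kz e0; have [->|v0] := eqVneq (row3 x y z) 0; first by exists 0; rewrite scale0r.
    have : pt3 M0 x y z \in B :&: pts linf.
      rewrite !inE el on_frame // e0 eqxx andbT; apply/BM0; by exists x, y, z.
    rewrite Binf inE eT => /eqP/(pt3_eq uM0 v0 tn0)[k [_ -> -> ->]].
    by exists k; rewrite row3Z.
  have [k0 e0] := multT _ _ _ Ka0 Kb0 Kc0 d0.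
  have [k1 e1] := multT _ _ _ Ka1 Kb1 Kc1 d1.
  have ep : row3 a b c = (k0 + w * k1) *: row3 t0 t1 t2.
    rewrite scalerDl -scalerA -e0 -e1 -[X in X + _]scale1r row3_lin !mul1r.
    by rewrite -ea -eb -ec.
  case/negP: PT; rewrite eP eT /pt3 ep -scalemxAl mkptZ ?mulmxM_eq0 //.
  by apply: contraNneq p0 => k; rewrite ep k scale0r.
have eN x y z : row3 x y z *m (N *m M0) =
    (x *: row3 a0 b0 c0 + y *: row3 a1 b1 c1 + z *: row3 t0 t1 t2) *m M0.
  by rewrite mulmxA row3_mx3.
have eP' : P = pt3 (N *m M0) 1 w 0.
  by rewrite /pt3 eN scale0r addr0 row3_lin !mul1r -ea -eb -ec.
have eT' : T = pt3 (N *m M0) 0 0 1 by rewrite /pt3 eN !scale0r !add0r scale1r.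
have uM : N *m M0 \in unitmx by rewrite unitmx_mul uN.
exists (N *m M0), w; split=> //; first exact: baer_frame_mul.
apply: (line_uniq PT Plinf Tlinf); rewrite ?eP' ?eT' on_frame //; try by nz.
  by apply/eqP; ring.
Qed.

End NormalFrame.

(** * Pencils as Hermitian loci *)

Section Pencils.
Variables (F : finFieldType) (q : nat) (M : 'M[F]_3) (w : F).
Hypotheses (cardF : #|F| = (q ^ 2)%N) (uM : M \in unitmx) (wK : ~~ inK q w).
Local Notation "x ^bar" := (cj q x) (at level 2, format "x ^bar").
Local Notation P := (pt3 M 1 w 0).
Local Notation linf := (ln3 M w (-1) 0).
Local Notation cjE := (cjD cardF, cjN cardF, cjM, cjV, cjK cardF, cj0 cardF, cj1).

(** A Hermitian equation in (u, z) without a term in z^(q+1), so that it holds on u = 0, which is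
    [linf]. *)
Definition herm_form (g c u z : F) := g * z * u^bar + g^bar * z^bar * u == c * (u * u^bar).

Definition herm_pencil (g c : F) : {set point F} :=
  [set Z | let v := val Z *m invmx M in herm_form g c (v 0 1 - w * v 0 0) (v 0 2)].

Lemma mem_herm_pencil g c x y z : row3 x y z != 0 ->
  (pt3 M x y z \in herm_pencil g c) = herm_form g c (y - w * x) z.
Proof.
move=> v0; rewrite inE /pt3; have [|k k0 ->] := @val_mkpt _ (row3 x y z *m M).
  by rewrite mulmxM_eq0.
rewrite -scalemxAl mulmxK // row3Z !row3E /herm_form.
have -> : k * y - w * (k * x) = k * (y - w * x) by ring.
(* Rescaling the representative by k multiplies the equation by the norm k^(q+1), which is
   nonzero. *)
rewrite !cjM -subr_eq0 -[RHS]subr_eq0.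
rewrite [X in (X == 0) = _](_ : _ = k * k^bar *
  (g * z * (y - w * x)^bar + g^bar * z^bar * (y - w * x) - c * ((y - w * x) * (y - w * x)^bar))).
  by rewrite !mulf_eq0 (negPf k0) cj_eq0 // (negPf k0).
by ring.
Qed.

Lemma vertex_coords x y z : row3 x y z != 0 ->
  (pt3 M x y z == P) = (y - w * x == 0) && (z == 0).
Proof.
move=> v0; have p0 : row3 1 w 0 != 0 by nz.
apply/eqP/andP=> [/(pt3_eq uM v0 p0)[c [_ -> -> ->]]|[]].
  by rewrite mulr0 mulr1 mulrC subrr.
rewrite subr_eq0 => /eqP ey /eqP ez; have x0 : x != 0.
  by apply: contraNneq v0 => e; rewrite row3_eq0 ey ez e mulr0 eqxx.
by rewrite -(pt3Z uM x0 p0) mulr1 mulr0 ey ez mulrC.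
Qed.

Lemma collinear_vertex x y z x' y' z' : row3 x y z != 0 -> row3 x' y' z' != 0 ->
  pt3 M x y z != P ->
  collinear P (pt3 M x y z) (pt3 M x' y' z') =
  ((y - w * x) * z' == (y' - w * x') * z).
Proof.
move=> v0 v0' XP; have p0 : row3 1 w 0 != 0 by nz.
apply/existsP/eqP=> [[l]|e].
  have [a [b [c [n0 ->]]]] := ln3_surj uM l; rewrite !on_frame //.
  case/and3P=> /eqP e1 /eqP e2 /eqP e3.
  have ea : a = - (w * b) by apply/eqP; rewrite -addr_eq0 -e1; apply/eqP; ring.
  have f2 : b * (y - w * x) + c * z = 0 by rewrite -e2 ea; ring.
  have f3 : b * (y' - w * x') + c * z' = 0 by rewrite -e3 ea; ring.
  apply/eqP; rewrite -subr_eq0; have [b0|b0] := eqVneq b 0.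
    have c0 : c != 0.
      by apply: contraNneq n0 => c0; rewrite row3_eq0 ea b0 c0 mulr0 oppr0 eqxx.
    move: f2 f3; rewrite b0 !mul0r !add0r => /eqP + /eqP.
    by rewrite !mulf_eq0 (negPf c0) /= => /eqP-> /eqP->; rewrite !mulr0 subr0.
  rewrite -(mulrI_eq0 _ (mulfI b0)); apply/eqP.
  transitivity ((b * (y - w * x) + c * z) * z' - (b * (y' - w * x') + c * z') * z); first by ring.
  by rewrite f2 f3 !mul0r subr0.
(* This is the dual vector of the join of [P] with the first point; it is nonzero because that point
   is not [P]. *)
have n0 : row3 (- (w * z)) z (- (y - w * x)) != 0.
  apply: contra XP; rewrite row3_eq0 vertex_coords // oppr_eq0 => /and3P[_ /eqP-> ].
  by rewrite oppr_eq0 eqxx andbT.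
exists (ln3 M (- (w * z)) z (- (y - w * x))); rewrite !on_frame //; apply/and3P.
split; apply/eqP; [by ring|by ring|].
transitivity ((y' - w * x') * z - (y - w * x) * z'); first by ring.
by rewrite e subrr.
Qed.

(** Conjugating a relation over K gives a second one with the same coefficients, so the determinant
    of the system vanishes. Conversely, for D nonzero the equation says that A / D is in K. *)
Lemma dependent_over_K (A D : F) :
  (exists x y, [/\ inK q x, inK q y, (x, y) != (0, 0) & x * A + y * D = 0]) <->
  A * D^bar = A^bar * D.
Proof.
split=> [[x [y [/inKP Kx /inKP Ky xy0 e]]]|e].
  have ec : x * A^bar + y * D^bar = 0.
    by move/(congr1 (cj q)): e; rewrite !cjE Kx Ky.
  apply/eqP; rewrite -subr_eq0.
  have ex : x * (A * D^bar - A^bar * D) = 0.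
    transitivity ((x * A + y * D) * D^bar - (x * A^bar + y * D^bar) * D); first by ring.
    by rewrite e ec !mul0r subr0.
  have ey : y * (A * D^bar - A^bar * D) = 0.
    transitivity (A * (x * A^bar + y * D^bar) - A^bar * (x * A + y * D)); first by ring.
    by rewrite e ec !mulr0 subr0.
  move: xy0; rewrite xpair_eqE negb_and => /orP[x0|y0].
    by move/eqP: ex; rewrite mulf_eq0 (negPf x0).
  by move/eqP: ey; rewrite mulf_eq0 (negPf y0).
have [D0|D0] := eqVneq D 0.
  exists 0, 1; rewrite (inK0 cardF) inK1 D0 mulr0 mul0r addr0; split=> //.
  by rewrite xpair_eqE oner_eq0 andbF.
exists 1, (- (A / D)); rewrite inK1 (inKN cardF); split=> //.
- rewrite inKE cjM cjV; apply/eqP.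
  have D0' : D^bar != 0 by rewrite cj_eq0.
  apply: (mulIf (mulf_neq0 D0 D0')); transitivity (A^bar * D); first by field; rewrite D0'.
  by rewrite -e; field; rewrite D0.
- by rewrite xpair_eqE oner_eq0.
by field; rewrite D0.
Qed.

Definition subline_of (a d : 'rV[F]_3) : {set point F} :=
  [set X | [exists x : F, exists y : F,
     [&& inK q x, inK q y, (x, y) != (0, 0) & represents X (x *: a + y *: d)]]].

Section Subline.
Variables a0 a1 a2 d0 d1 d2 : F.
Local Notation b := (subline_of (row3 a0 a1 a2 *m M) (row3 d0 d1 d2 *m M)).
Local Notation ua := (a1 - w * a0).
Local Notation ud := (d1 - w * d0).
Hypothesis indep : forall x y, x *: row3 a0 a1 a2 + y *: row3 d0 d1 d2 = 0 -> x = 0 /\ y = 0.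
Local Notation comb x y := (pt3 M (x * a0 + y * d0) (x * a1 + y * d1) (x * a2 + y * d2)).

Lemma comb_neq0 x y : (x, y) != (0, 0) ->
  row3 (x * a0 + y * d0) (x * a1 + y * d1) (x * a2 + y * d2) != 0.
Proof. by rewrite -row3_lin; apply: contra => /eqP/indep[-> ->]. Qed.

Lemma mem_subline X : X \in b <->
  exists x y, [/\ inK q x, inK q y, (x, y) != (0, 0) & X = comb x y].
Proof.
rewrite inE; split=> [/existsP[x /existsP[y /and4P[Kx Ky xy0]]]|[x [y [Kx Ky xy0 ->]]]].
  rewrite !scalemxAl -mulmxDl row3_lin represents_frame // => /andP[_ /eqP->].
  by exists x, y.
apply/existsP; exists x; apply/existsP; exists y; rewrite Kx Ky xy0 /=.
by rewrite !scalemxAl -mulmxDl row3_lin represents_frame // eqxx comb_neq0.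
Qed.

(** A and D compare the point with the two base vectors under projection from [P]. The base point s
    a + t d is collinear with [P] and the point exactly when s A + t D = 0, so membership is
    dependence over K. *)
Lemma mem_pencil x y z : P \notin b -> row3 x y z != 0 ->
  let A := (y - w * x) * a2 - z * ua in
  let D := (y - w * x) * d2 - z * ud in
  (pt3 M x y z \in pencil P b) = (A * D^bar == A^bar * D).
Proof.
move=> Pb v0 A D; have combP s t : inK q s -> inK q t -> (s, t) != (0, 0) ->
    collinear P (comb s t) (pt3 M x y z) <-> s * A + t * D = 0.
  move=> Ks Kt st0; rewrite collinear_vertex ?comb_neq0 //; last first.
    by apply: contraNneq Pb => <-; apply/mem_subline; exists s, t.
  rewrite eq_sym -subr_eq0; split=> [/eqP e|e].
    by rewrite -[RHS]e /A /D; ring.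
  by apply/eqP; rewrite -[RHS]e /A /D; ring.
rewrite inE; apply/existsP/eqP=> [[X /andP[/mem_subline[s [t [Ks Kt st0 ->]]]]]|].
  by move/(combP _ _ Ks Kt st0) => e; apply/dependent_over_K; exists s, t.
move/dependent_over_K=> [s [t [Ks Kt st0 e]]]; exists (comb s t).
by apply/andP; split; [apply/mem_subline; exists s, t | apply/combP].
Qed.

(* The Hermitian form A D^q - A^q D in (u, z) loses its z^(q+1) term because
   the base meets u = 0; multiplying by w - w^q makes its values lie in K. *)
Lemma subline_pencil x0 y0 : P \notin b -> inK q x0 -> inK q y0 -> (x0, y0) != (0, 0) ->
  x0 * ua + y0 * ud = 0 ->
  pencil P b = herm_pencil ((w - w^bar) * (a2^bar * ud - d2^bar * ua))
                           (- (w - w^bar) * (a2 * d2^bar - a2^bar * d2)).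
Proof.
move=> Pb Kx0 Ky0 xy0 e0; apply/setP=> Z.
have eu : ua * ud^bar = ua^bar * ud by apply/dependent_over_K; exists x0, y0.
have [x [y [z [v0 ->]]]] := pt3_surj uM Z; rewrite mem_pencil // mem_herm_pencil //.
set u := y - w * x; set A := ua in eu *; set D := ud in eu *.
rewrite /herm_form -subr_eq0 -[RHS]subr_eq0 !cjE.
rewrite [X in (X == 0) = _](_ : _ = (w - w^bar)^-1 *
  ((w - w^bar) * (a2^bar * D - d2^bar * A) * z * u^bar + (w^bar - w) * (a2 * D^bar - d2 * A^bar) * z^bar * u
   + (w - w^bar) * (a2 * d2^bar - a2^bar * d2) * (u * u^bar)) + z * z^bar * (A * D^bar - A^bar * D)).
  rewrite eu subrr mulr0 addr0 mulf_eq0 invr_eq0 (negPf (subcj_neq0 wK)) /=.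
  by congr (_ == 0); rewrite /u /A /D !cjE; ring.
rewrite /u /A /D !cjE; field; exact: subcj_neq0.
Qed.

End Subline.

Lemma on_linf x y z : row3 x y z != 0 -> on (pt3 M x y z) linf = (y - w * x == 0).
Proof.
move=> v0; rewrite on_frame //; last by nz.
by rewrite -oppr_eq0; congr (_ == 0); ring.
Qed.

Lemma linf_baer_pencilP Pi : linf_baer_pencil q linf P Pi <->
  exists g c, [/\ g != 0, inK q c & Pi = herm_pencil g c].
Proof.
have dl := subcj_neq0 wK.
split.
  case/existsP=> b /and5P[/existsP[a /existsP[d /andP[/rank2P ind /eqP eb]]] Pb _ /cards1P[X0 eX0] /eqP->].
  have [a0 [a1 [a2 ea]]] := row3_surj (a *m invmx M).
  have [d0 [d1 [d2 ed]]] := row3_surj (d *m invmx M).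
  have {}ea : a = row3 a0 a1 a2 *m M by rewrite -ea mulmxKV.
  have {}ed : d = row3 d0 d1 d2 *m M by rewrite -ed mulmxKV.
  have indep x y : x *: row3 a0 a1 a2 + y *: row3 d0 d1 d2 = 0 -> x = 0 /\ y = 0.
    by move=> e; apply: ind; rewrite ea ed !scalemxAl -mulmxDl e mul0mx.
  have {}eb : b = subline_of (row3 a0 a1 a2 *m M) (row3 d0 d1 d2 *m M) by rewrite -ea -ed.
  have [X0b X0l] : X0 \in b /\ on X0 linf.
    by move: (set11 X0); rewrite -eX0 !inE => /andP[].
  rewrite eb in Pb X0b *.
  have [x0 [y0 [Kx0 Ky0 xy0 eX]]] := (mem_subline indep X0).1 X0b.
  have v0 := comb_neq0 indep xy0.
  have e0 : x0 * (a1 - w * a0) + y0 * (d1 - w * d0) = 0.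
    by move: X0l; rewrite eX on_linf // => /eqP <-; ring.
  exists ((w - w^bar) * (a2^bar * (d1 - w * d0) - d2^bar * (a1 - w * a0))).
  exists (- (w - w^bar) * (a2 * d2^bar - a2^bar * d2)); split.
  (* The base meets [linf] in a point other than [P], so its z-coordinate is nonzero. With g = 0
     this would make both base vectors satisfy u = 0, and the whole base would collapse to the
     single point [X0]. *)
  - rewrite mulf_neq0 //; apply/negP=> /eqP G0.
    have z0 : x0 * a2 + y0 * d2 != 0.
      apply: contra Pb => /eqP z0; apply/(mem_subline indep); exists x0, y0; split=> //.
      apply/esym/eqP; rewrite vertex_coords // z0 eqxx andbT; apply/eqP.
      by rewrite -[RHS]e0; ring.
    have z0' : x0 * a2^bar + y0 * d2^bar != 0.
      rewrite -(cj_eq0 cardF) in z0; apply: contra z0 => /eqP e.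
      by rewrite !cjE (inKP Kx0) (inKP Ky0) e.
    have ud0 : d1 - w * d0 = 0.
      apply: (mulfI z0'); rewrite mulr0.
      transitivity (x0 * (a2^bar * (d1 - w * d0) - d2^bar * (a1 - w * a0)) +
                    d2^bar * (x0 * (a1 - w * a0) + y0 * (d1 - w * d0))); first by ring.
      by rewrite G0 e0 !mulr0 addr0.
    have ua0 : a1 - w * a0 = 0.
      apply: (mulfI z0'); rewrite mulr0.
      transitivity (- y0 * (a2^bar * (d1 - w * d0) - d2^bar * (a1 - w * a0)) +
                    a2^bar * (x0 * (a1 - w * a0) + y0 * (d1 - w * d0))); first by ring.
      by rewrite G0 e0 !mulr0 addr0.
    have inl x y : inK q x -> inK q y -> (x, y) != (0, 0) ->
       pt3 M (x * a0 + y * d0) (x * a1 + y * d1) (x * a2 + y * d2) = X0.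
      move=> Kx Ky n0; apply/set1P; rewrite -eX0 eb in_setI; apply/andP; split.
        by apply/(mem_subline indep); exists x, y.
      rewrite inE on_linf ?comb_neq0 //.
      apply/eqP; transitivity (x * (a1 - w * a0) + y * (d1 - w * d0)); first by ring.
      by rewrite ua0 ud0 !mulr0 addr0.
    have n10 : (1 : F, 0 : F) != (0, 0) by rewrite xpair_eqE oner_eq0.
    have n01 : (0 : F, 1 : F) != (0, 0) by rewrite xpair_eqE oner_eq0 andbF.
    have := inl _ _ (inK0 cardF) (inK1 F q) n01.
    rewrite -(inl _ _ (inK1 F q) (inK0 cardF) n10).
    case/(pt3_eq uM (comb_neq0 indep n01) (comb_neq0 indep n10)).
    rewrite !(mul0r, mul1r, add0r, addr0) => c [_ h0 h1 h2].
    have [|_ /eqP] := indep c (-1); last by rewrite oppr_eq0 oner_eq0.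
    by rewrite row3_lin h0 h1 h2 !mulN1r !subrr; apply/eqP; rewrite row3_eq0 eqxx.
  - by rewrite inKE !cjE; apply/eqP; ring.
  - exact: subline_pencil Kx0 Ky0 xy0 e0.
case=> g [c [g0 /inKP Kc ->]].
(* The base is taken on x = 0 with vectors (0,0,be) and (0,1,al), whose u-values are 0 and 1. In the
   formulas of [subline_pencil], g then determines be, and al solves the equation for c because c (w
   - w^q) / (w - w^q) = c with c in K. *)
pose be := (g / (w - w^bar))^bar; pose al := c * w / ((w - w^bar) * g).
have be0 : be != 0 by rewrite cj_eq0 // mulf_neq0 ?invr_eq0.
have dl' : w^bar - w != 0 by rewrite -opprB oppr_eq0.
have g0' : g^bar != 0 by rewrite cj_eq0.
have indep x y : x *: row3 0 0 be + y *: row3 0 1 al = 0 -> x = 0 /\ y = 0.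
  rewrite row3_lin => /eqP; rewrite row3_eq0; simp01 => /and3P[_ /eqP->].
  by rewrite mul0r addr0 mulf_eq0 (negPf be0) orbF => /eqP->.
pose b := subline_of (row3 0 0 be *m M) (row3 0 1 al *m M).
have n10 : (1 : F, 0 : F) != (0, 0) by rewrite xpair_eqE oner_eq0.
have mem_linf x y : (x, y) != (0, 0) -> 
    on (pt3 M (x * 0 + y * 0) (x * 0 + y * 1) (x * be + y * al)) linf -> y = 0.
  by move=> /(comb_neq0 indep) n0; rewrite on_linf //; simp01; rewrite subr0 => /eqP.
have Pb : P \notin b.
  apply/negP=> /(mem_subline indep)[x [y [_ _ xy0 eP]]].
  have y0 : y = 0.
    by apply: (mem_linf _ _ xy0); rewrite -eP on_linf; [apply/eqP; ring | nz].
  have : pt3 M (x * 0 + y * 0) (x * 0 + y * 1) (x * be + y * al) == P by rewrite -eP.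
  rewrite vertex_coords ?(comb_neq0 indep) // y0; simp01; rewrite mulf_eq0 (negPf be0) orbF.
  by case/andP=> _ /eqP x0; rewrite x0 y0 eqxx in xy0.
apply/existsP; exists b; apply/and5P; split=> //.
- apply/existsP; exists (row3 0 0 be *m M); apply/existsP; exists (row3 0 1 al *m M).
  rewrite eqxx andbT; apply/rank2P=> x y; rewrite !scalemxAl -mulmxDl => /eqP.
  by rewrite mulmxM_eq0 // => /eqP/indep.
- by rewrite on_linf; [apply/eqP; ring | nz].
- apply/cards1P; exists (pt3 M 0 0 be); apply/setP=> X; rewrite in_setI in_set1.
  have vb : row3 0 0 be != 0 by rewrite row3_eq0 (negPf be0) !andbF.
  apply/andP/eqP=> [[/(mem_subline indep)[x [y [_ _ xy0 ->]]]]|->].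
    rewrite inE => /(mem_linf _ _ xy0) y0; rewrite y0 in xy0 *; simp01.
    have x0 : x != 0 by move: xy0; rewrite xpair_eqE eqxx andbT.
    by rewrite -(pt3Z uM x0 vb) mulr0.
  split; last by rewrite inE on_linf //; apply/eqP; ring.
  apply/(mem_subline indep); exists 1, 0; rewrite (inK0 cardF) inK1; split=> //.
  by simp01.
rewrite (@subline_pencil 0 0 be 0 1 al indep 1 0) ?(inK0 cardF) ?inK1 //; last by ring.
apply/eqP; congr herm_pencil; rewrite /be /al !cjE ?Kc; field.
by rewrite dl dl' g0'.
by rewrite dl dl' g0 g0'.
Qed.

End Pencils.

(** * Intersections with the subplane *)

Lemma mem_pts (F : finFieldType) (X : point F) l : (X \in pts l) = on X l.
Proof. by rewrite inE. Qed.

Lemma mem_ptsU (F : finFieldType) (X : point F) l m :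
  (X \in pts l :|: pts m) = on X l || on X m.
Proof. by rewrite in_setU !mem_pts. Qed.

(** * Non-degenerate ternary quadratic forms contain no line *)

Section Conics.
Variable F : finFieldType.

Definition qf (a b c f g h x y z : F) :=
  a * x ^+ 2 + b * y ^+ 2 + c * z ^+ 2 + f * y * z + g * z * x + h * x * y.

Definition disc (a b c f g h : F) :=
  4%:R * a * b * c + f * g * h - a * f ^+ 2 - b * g ^+ 2 - c * h ^+ 2.

Lemma qform_row3 a b c f g h x y z :
  qform a b c f g h (row3 x y z) = qf a b c f g h x y z.
Proof. by rewrite /qform !row3E. Qed.

(* The discriminant of the form in the basis v, v', e_3, whose determinant is
   the minor x y' - x' y. *)
Lemma disc_minor a b c f g h x y z x' y' z' :
  qf a b c f g h x y z = 0 -> qf a b c f g h x' y' z' = 0 ->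
  qf a b c f g h (x + x') (y + y') (z + z') = 0 ->
  disc a b c f g h != 0 -> x * y' = x' * y.
Proof.
move=> e1 e2 e3 d0; apply/eqP; rewrite -subr_eq0 -sqrf_eq0; apply/eqP/(mulfI d0).
rewrite mulr0.
pose H := qf a b c f g h (x + x') (y + y') (z + z') - qf a b c f g h x y z - qf a b c f g h x' y' z'.
have H0 : H = 0 by rewrite /H e1 e2 e3 !subr0.
transitivity (disc (qf a b c f g h x y z) (qf a b c f g h x' y' z') c
   (g * x' + f * y' + 2%:R * c * z') (g * x + f * y + 2%:R * c * z) H).
  by rewrite /H /disc /qf; ring.
by rewrite e1 e2 H0 /disc; ring.
Qed.

Lemma disc_rot a b c f g h : disc b c a g h f = disc a b c f g h.
Proof. by rewrite /disc; ring. Qed.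

Lemma qf_rot a b c f g h x y z : qf b c a g h f y z x = qf a b c f g h x y z.
Proof. by rewrite /qf; ring. Qed.

(** The three zeros make the form vanish on the span of both vectors. [disc_minor] and its cyclic
    rotations kill every 2 by 2 minor, without dividing by 2. *)
Lemma disc_proportional a b c f g h x y z x' y' z' :
  qf a b c f g h x y z = 0 -> qf a b c f g h x' y' z' = 0 ->
  qf a b c f g h (x + x') (y + y') (z + z') = 0 ->
  disc a b c f g h != 0 -> row3 x y z != 0 ->
  exists k, row3 x' y' z' = k *: row3 x y z.
Proof.
move=> e1 e2 e3 d0 v0.
have exy := disc_minor e1 e2 e3 d0.
have [eyz ezx] : y * z' = y' * z /\ z * x' = z' * x.
  rewrite -qf_rot in e1; rewrite -qf_rot in e2; rewrite -qf_rot in e3; rewrite -disc_rot in d0.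
  split; first exact: disc_minor e1 e2 e3 d0.
  rewrite -qf_rot in e1; rewrite -qf_rot in e2; rewrite -qf_rot in e3; rewrite -disc_rot in d0.
  exact: disc_minor e1 e2 e3 d0.
have [x0|x0] := eqVneq x 0; last first.
  exists (x' / x); rewrite row3Z; congr row3; apply: (mulfI x0).
  - by field.
  - by rewrite exy; field.
  - by rewrite [LHS]mulrC -ezx; field.
have [y0|y0] := eqVneq y 0; last first.
  exists (y' / y); rewrite row3Z; congr row3; apply: (mulfI y0).
  - by rewrite [LHS]mulrC -exy; field.
  - by field.
  - by rewrite eyz; field.
have z0 : z != 0 by move: v0; rewrite row3_eq0 x0 y0 eqxx.
exists (z' / z); rewrite row3Z; congr row3; apply: (mulfI z0).
- by rewrite ezx; field.
- by rewrite [LHS]mulrC -eyz; field.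
- by field.
Qed.

Variables (q : nat) (B : {set point F}).
Hypothesis cardF : #|F| = (q ^ 2)%N.

(** This separates the two types. The frame is the one that presents the conic, whatever frame is
    used for the pencils. *)
Lemma conic_no_line (C : {set point F}) l :
  conic_of q B C -> line_of q B l -> ~~ (pts l :&: B \subset C).
Proof.
case/existsP=> M /andP[fM]; have [uM BM] := (baer_frameP q M B).1 fM.
case/existsP=> a /existsP[b /existsP[c /existsP[f /existsP[g /existsP[h]]]]].
case/and3P=> _ d0 /eqP eC /eqP cl; apply/negP=> /subsetP sub.
have memC X : X \in C -> exists x y z, [/\ inK q x, inK q y, inK q z, row3 x y z != 0 &
    qf a b c f g h x y z = 0 /\ X = pt3 M x y z].
  rewrite eC inE => /existsP[v]; have [x [y [z ->]]] := row3_surj v.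
  rewrite represents_frame // Kvec_row3 qform_row3.
  by case/and4P=> v0 /and3P[? ? ?] /eqP e /andP[_ /eqP->]; exists x, y, z.
have /card_gt1P[X [Y [Xl Yl XY]]] : (1 < #|pts l :&: B|)%N.
  by rewrite cl ltnS ltnW // (order_gt1 cardF).
have [x [y [z [Kx Ky Kz v0 [e1 eX]]]]] := memC _ (sub _ Xl).
have [x' [y' [z' [Kx' Ky' Kz' v0' [e2 eY]]]]] := memC _ (sub _ Yl).
have nprop k : row3 x' y' z' <> k *: row3 x y z.
  move=> e; case/negP: XY; rewrite eX eY /pt3 e -scalemxAl mkptZ ?mulmxM_eq0 //.
  by apply: contraNneq v0' => k0; rewrite e k0 scale0r.
have s0 : row3 (x + x') (y + y') (z + z') != 0.
  apply/negP; rewrite row3_eq0 !addr_eq0 => /and3P[/eqP ex /eqP ey /eqP ez].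
  by apply: (nprop (-1)); rewrite row3Z ex ey ez !mulN1r !opprK.
(* The sum of the K-vectors of two points of the line gives a third point of the line in [B], so the
   form vanishes there too. *)
have /sub/memC[r [s [t [_ _ _ v1 [e3]]]]] :
    pt3 M (x + x') (y + y') (z + z') \in pts l :&: B.
  have [n0 [n1 [n2 [nn0 el]]]] := ln3_surj uM l.
  rewrite in_setI mem_pts; apply/andP; split; last first.
    apply/BM; exists (x + x'), (y + y'), (z + z').
    by split=> //; apply: (inKD cardF).
  move: Xl Yl; rewrite !in_setI !mem_pts eX eY el !on_frame //.
  move=> /andP[/eqP l1 _] /andP[/eqP l2 _]; apply/eqP.
  transitivity ((x * n0 + y * n1 + z * n2) + (x' * n0 + y' * n1 + z' * n2)); first by ring.
  by rewrite l1 l2 addr0.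
case/(pt3_eq uM s0 v1)=> k [k0 er es et].
have e4 : qf a b c f g h (x + x') (y + y') (z + z') = 0.
  rewrite er es et; transitivity (k ^+ 2 * qf a b c f g h r s t); first by rewrite /qf; ring.
  by rewrite e3 mulr0.
by have [m em] := disc_proportional e1 e2 e4 d0 v0; apply: (nprop m).
Qed.

End Conics.

(** * The two shapes of intersection, and when two equations give the same pencil *)

Section Intersections.
Variables (F : finFieldType) (q : nat) (B : {set point F}) (M : 'M[F]_3) (w : F).
Hypotheses (cardF : #|F| = (q ^ 2)%N) (subB : baer_subplane q B).
Hypotheses (fM : baer_frame q M B) (wK : ~~ inK q w).
Local Notation "x ^bar" := (cj q x) (at level 2, format "x ^bar").
Local Notation P := (pt3 M 1 w 0).
Local Notation T := (pt3 M 0 0 1).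
Local Notation cjE := (cjD cardF, cjN cardF, cjM, cjV, cjK cardF, cj0 cardF, cj1).
Local Notation Pi := (herm_pencil q M w).
Hypothesis PB : P \notin B.

Let uM : M \in unitmx := ((baer_frameP q M B).1 fM).1.
Let BM := ((baer_frameP q M B).1 fM).2.

Local Notation m0 := (ln3 M 0 0 1).
(** The form L = Tr(g u^q), K-linear in x, y, extended F-linearly; the two agree only for x, y in K.
    For every nonzero c, the line L = 0 is the tangent at [T] to the conic z L = c N. *)
Definition tangent_line g := ln3 M (- (g * w^bar + g^bar * w)) (g + g^bar) 0.

Lemma tangent_line_neq0 g : g != 0 -> row3 (- (g * w^bar + g^bar * w)) (g + g^bar) 0 != 0.
Proof.
move=> g0; rewrite row3_eq0 oppr_eq0 eqxx andbT; apply/negP=> /andP[/eqP e1 /eqP e2].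
have : g * (w - w^bar) = 0.
  transitivity ((g + g^bar) * w - (g * w^bar + g^bar * w)); first by ring.
  by rewrite e1 e2 mul0r subr0.
by move/eqP; rewrite mulf_eq0 (negPf g0) (negPf (subcj_neq0 wK)).
Qed.

Lemma trace_inK (g : F) : inK q (g + g^bar).
Proof. by rewrite inKE !cjE addrC. Qed.

Lemma trace_inK' (g : F) : inK q (g * w^bar + g^bar * w).
Proof. by rewrite inKE !cjE addrC. Qed.

Lemma on_tangent_line g x y z : g != 0 -> inK q x -> inK q y -> row3 x y z != 0 ->
  on (pt3 M x y z) (tangent_line g) = (g * (y - w * x)^bar + g^bar * (y - w * x) == 0).
Proof.
move=> g0 /inKP Kx /inKP Ky v0; rewrite on_frame ?tangent_line_neq0 // !cjE Kx Ky.
by congr (_ == 0); ring.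
Qed.

Lemma mem_frame x y z : inK q x -> inK q y -> inK q z -> row3 x y z != 0 -> pt3 M x y z \in B.
Proof. by move=> Kx Ky Kz v0; apply/BM; exists x, y, z. Qed.

Let K0 : inK q (0 : F) := inK0 cardF.
Let K1 : inK q (1 : F) := inK1 _ _.

Lemma line_of_rich l : line_of q B l -> rich B l.
Proof. by move/eqP=> e; rewrite /rich e ltnS ltnW // (order_gt1 cardF). Qed.

Lemma m0_line : line_of q B m0 && on P m0.
Proof.
have n0 : row3 (0 : F) 0 1 != 0 by nz.
have v1 : row3 (1 : F) 0 0 != 0 by nz.
have v2 : row3 (0 : F) 1 0 != 0 by nz.
apply/andP; split; last by rewrite on_frame //; [apply/eqP; ring | nz].
apply/eqP/(rich_card subB)/(rich2 (mem_frame K1 K0 K0 v1) (mem_frame K0 K1 K0 v2)).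
- by apply/eqP=> /(pt3_eq uM v1 v2)[c [_ /eqP]]; rewrite mulr0 oner_eq0.
- by rewrite on_frame //; apply/eqP; ring.
- by rewrite on_frame //; apply/eqP; ring.
Qed.

(** Two lines of [B] meet inside [B], and [P] is outside. *)
Lemma m0_uniq m : line_of q B m && on P m -> m0 = m.
Proof.
case/andP=> /line_of_rich rm Pm; case/andP: m0_line => /line_of_rich r0 P0.
by apply/eqP; apply: contraR PB => ne; exact: (rich_meet subB r0 rm ne P0 Pm).
Qed.

Lemma on_m0 x y z : row3 x y z != 0 -> on (pt3 M x y z) m0 = (z == 0).
Proof. by move=> v0; rewrite on_frame //; [simp01 | nz]. Qed.

Lemma T_tangent_line g : g != 0 -> on T (tangent_line g).
Proof.
by move=> g0; rewrite on_tangent_line //; [rewrite !cjE; apply/eqP; ring | nz].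
Qed.

Lemma tangent_line_line g : g != 0 -> line_of q B (tangent_line g).
Proof.
move=> g0; have v1 : row3 (0 : F) 0 1 != 0 by nz.
have v2 : row3 (g + g^bar) (g * w^bar + g^bar * w) 0 != 0.
  by move: (tangent_line_neq0 g0); rewrite !row3_eq0 oppr_eq0 eqxx !andbT andbC.
apply/eqP/(rich_card subB).
apply: (rich2 (mem_frame K0 K0 K1 v1) (mem_frame (trace_inK g) (trace_inK' g) K0 v2)).
- by apply/eqP=> /(pt3_eq uM v1 v2)[c [_ _ _ /eqP]]; rewrite mulr0 oner_eq0.
- exact: T_tangent_line.
by rewrite on_frame ?tangent_line_neq0 //; apply/eqP; ring.
Qed.

Lemma lineT n : line_of q B n -> on T n -> exists2 g, g != 0 & n = tangent_line g.
Proof.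
move=> /line_of_rich/card_gt1P[X [Y [Xn Yn XY]]] Tn.
have [Z [ZB Zn ZT]] : exists Z, [/\ Z \in B, on Z n & T != Z].
  move: Xn Yn; rewrite !inE => /andP[Xn XB] /andP[Yn YB].
  have [TX|TX] := eqVneq T X; last by exists X.
  by exists Y; rewrite TX.
have [x [y [z [Kx Ky Kz v0 eZ]]]] := (BM Z).1 ZB.
(* If u = 0 with x nonzero, then w = y / x lies in K; with x = 0 the point is [T]. *)
have u0 : y - w * x != 0.
  apply: contra ZT => u0; rewrite eZ; have x0 : x = 0.
    apply/eqP; apply: contraR wK => x0; rewrite (_ : w = y / x) ?(inKM Ky) ?(inKV q) //.
    by move: u0; rewrite subr_eq0 => /eqP->; field.
  have y0 : y = 0 by move: u0; rewrite x0 mulr0 subr0 => /eqP.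
  have z0 : z != 0 by move: v0; rewrite row3_eq0 x0 y0 eqxx.
  have v1 : row3 (0 : F) 0 1 != 0 by nz.
  by rewrite -(pt3Z uM z0 v1) mulr0 mulr1 x0 y0.
(* Conjugation negates w - w^q, so Tr(g u^q) = 0 at the chosen point. *)
pose g := (w - w^bar) * (y - w * x).
have g0 : g != 0 by rewrite mulf_neq0 // subcj_neq0.
exists g => //; apply: (line_uniq ZT Tn Zn (T_tangent_line g0)).
rewrite eZ on_tangent_line // /g !cjE (inKP Kx) (inKP Ky); apply/eqP; ring.
Qed.

Lemma mem_pencil_K g c x y z : inK q x -> inK q y -> inK q z -> row3 x y z != 0 ->
  (pt3 M x y z \in Pi g c) =
  (z * (g * (y - w * x)^bar + g^bar * (y - w * x)) == c * ((y - w * x) * (y - w * x)^bar)).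
Proof.
move=> Kx Ky Kz v0; rewrite mem_herm_pencil // /herm_form (inKP Kz).
by congr (_ == _); ring.
Qed.

Lemma pencil_conic g c : g != 0 -> c != 0 -> inK q c -> conic_of q B (Pi g c :&: B).
Proof.
move=> g0 c0 Kc; apply/existsP; exists M; rewrite fM /=.
(* The six coefficients are those of c N(y - w x) - z L(x, y), expanded for x, y in K. *)
apply/existsP; exists (c * (w * w^bar)); apply/existsP; exists c.
apply/existsP; exists 0; apply/existsP; exists (- (g + g^bar)).
apply/existsP; exists (g * w^bar + g^bar * w).
apply/existsP; exists (- (c * (w + w^bar))); apply/and3P; split.
- have Kn : inK q (w * w^bar) by rewrite inKE !cjE mulrC.
  apply/forallP=> x; apply/implyP; rewrite !inE.
  have Kh := inKM Kc (trace_inK w).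
  by case/or4P=> [|||/or3P[]] /eqP->; rewrite ?(inKN cardF) ?trace_inK ?trace_inK' // inKM.
- rewrite /qform_nondeg (_ : _ - _ = c * g * g^bar * (w - w^bar) ^+ 2); last by ring.
  by rewrite !mulf_neq0 ?expf_neq0 ?cj_eq0 ?subcj_neq0.
apply/eqP/setP=> X; rewrite in_setI [RHS]inE; apply/andP/existsP.
  case=> XPi /BM[x [y [z [Kx Ky Kz v0 eX]]]]; move: XPi; rewrite eX mem_pencil_K // => /eqP e.
  exists (row3 x y z); rewrite represents_frame // v0 Kvec_row3 Kx Ky Kz eqxx /= andbT.
  rewrite qform_row3 /qf; apply/eqP; move/eqP: e; rewrite -subr_eq0 !cjE (inKP Kx) (inKP Ky) => /eqP e.
  by apply: oppr_inj; rewrite oppr0 -[RHS]e; ring.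
case=> v; have [x [y [z ->]]] := row3_surj v.
rewrite represents_frame // Kvec_row3 qform_row3 => /and4P[v0 /and3P[Kx Ky Kz] /eqP e /andP[_ /eqP->]].
split; last exact: mem_frame.
rewrite mem_pencil_K // !cjE (inKP Kx) (inKP Ky) -subr_eq0; apply/eqP.
by apply: oppr_inj; rewrite oppr0 -[RHS]e /qf; ring.
Qed.

Lemma pencil_two_lines g : g != 0 -> Pi g 0 :&: B = (pts m0 :|: pts (tangent_line g)) :&: B.
Proof.
move=> g0; apply/setP=> X; rewrite !in_setI; apply: andb_id2r => /BM[x [y [z [Kx Ky Kz v0 ->]]]].
by rewrite (mem_pencil_K _ _ Kx Ky Kz v0) mem_ptsU (on_m0 v0) (on_tangent_line g0 Kx Ky v0) mul0r mulf_eq0.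
Qed.

Lemma mem_two_lines g x y : g != 0 -> inK q x -> inK q y ->
  (pt3 M x y 1 \in (pts m0 :|: pts (tangent_line g)) :&: B) =
  (g * (y - w * x)^bar + g^bar * (y - w * x) == 0).
Proof.
move=> g0 Kx Ky; have v0 : row3 x y 1 != 0 by nz.
rewrite in_setI (mem_frame Kx Ky K1 v0) mem_ptsU (on_m0 v0) (on_tangent_line g0 Kx Ky v0).
by rewrite oner_eq0 andbT.
Qed.

Lemma pencil_typeI g c : g != 0 -> c != 0 -> inK q c -> typeI q B T (Pi g c).
Proof.
move=> g0 c0 Kc; have v1 : row3 (0 : F) 0 1 != 0 by nz.
rewrite /typeI pencil_conic // in_setI mem_frame // andbT mem_pencil_K //.
by rewrite !cjE; apply/eqP; ring.
Qed.

Lemma pencil_typeII_with g : g != 0 -> typeII_with q B P (tangent_line g) (Pi g 0).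
Proof.
move=> g0; case/andP: m0_line => l0 P0.
by apply/existsP; exists m0; rewrite l0 P0 pencil_two_lines ?eqxx.
Qed.

Lemma pencil_typeII g : g != 0 -> typeII q B P T (Pi g 0).
Proof.
move=> g0; apply/existsP; exists (tangent_line g).
by rewrite tangent_line_line // T_tangent_line // pencil_typeII_with.
Qed.

Lemma typeII_with_not_conic n Q : typeII_with q B P n Q -> ~~ conic_of q B (Q :&: B).
Proof.
case/existsP=> m /and3P[lm _ /eqP e]; apply/negP=> /(conic_no_line cardF)/(_ lm)/negP[].
by rewrite e setIUl subsetUl.
Qed.

(** This yields uniqueness of the pencil containing a given line through [T]: its coefficient g is
    fixed up to a factor in K. *)
Lemma typeII_with_coeffs g g' c : g != 0 -> g' != 0 -> inK q c ->
  typeII_with q B P (tangent_line g') (Pi g c) -> c = 0 /\ inK q (g / g').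
Proof.
move=> g0 g0' Kc h.
have c0 : c = 0.
  by apply/eqP; apply: contraNT (typeII_with_not_conic h) => c0; apply: pencil_conic.
split=> //; case/existsP: h => m /and3P[lm Pm]; rewrite c0.
have <- : m0 = m by apply: m0_uniq; rewrite lm.
(* The test point lies in [B] and on [tangent_line g'], and z = 1 keeps it off [m0]; so it must lie
   on [tangent_line g]. *)
move=> /eqP/setP/(_ (pt3 M (g' + g'^bar) (g' * w^bar + g'^bar * w) 1)) h.
have {h} := etrans (esym (mem_two_lines g0 (trace_inK g') (trace_inK' g')))
  (etrans (congr1 (fun A : {set point F} => _ \in A) (esym (pencil_two_lines g0)))
     (etrans h (mem_two_lines g0' (trace_inK g') (trace_inK' g')))).
rewrite !cjE.
rewrite [X in _ = (X == 0)](_ : _ = 0); last by ring.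
rewrite eqxx => /eqP e; rewrite inKE cjM cjV.
have gb0 : g'^bar != 0 by rewrite cj_eq0.
have : (w - w^bar) * (g * g'^bar - g^bar * g') = 0 by rewrite -[RHS]e; ring.
move/eqP; rewrite mulf_eq0 (negPf (subcj_neq0 wK)) => /eqP e'.
rewrite -subr_eq0 (_ : g^bar / g'^bar - g / g' = - (g * g'^bar - g^bar * g') / (g' * g'^bar)).
  by rewrite e' oppr0 mul0r.
by field; rewrite g0' gb0.
Qed.

Lemma herm_pencilZ k g c : k != 0 -> inK q k -> Pi (k * g) (k * c) = Pi g c.
Proof.
move=> k0 /inKP Kk; apply/setP=> X; rewrite !inE /herm_form /= cjM Kk.
rewrite -!mulrA -mulrDr; apply/eqP/eqP=> [/(mulfI k0)|->//].
by [].
Qed.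

(** On the points (0, 1, z), with z running over all of F, u = 1 and the equation is Tr(g z) = c.
    Two points of this trace fibre already determine (g, c) up to a factor in K. *)
Lemma herm_pencil_inj g c g' c' : g != 0 -> inK q c -> Pi g c = Pi g' c' ->
  inK q (g' / g) /\ c' = g' / g * c.
Proof.
move=> g0 /inKP Kc /setP e.
have dl := subcj_neq0 wK; have dl' : w^bar - w != 0 by rewrite -opprB oppr_eq0.
have gb0 : g^bar != 0 by rewrite cj_eq0.
have tr z : g * z + g^bar * z^bar = c -> g' * z + g'^bar * z^bar = c'.
  have v0 : row3 0 1 z != 0 by nz.
  move=> h; move: (e (pt3 M 0 1 z)); rewrite !mem_herm_pencil // /herm_form mulr0 subr0 cj1 !mulr1.
  by rewrite h eqxx => /esym/eqP.
(* Here z1 solves Tr(g z) = c, and z2 - z1 is in the kernel because w - w^q has trace 0. The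
   difference of the two primed equations puts g' / g in K; the one at z1 then gives c'. *)
pose z1 := c * w / ((w - w^bar) * g); pose z2 := z1 + (w - w^bar) / g.
have h1 : g * z1 + g^bar * z1^bar = c.
  by rewrite /z1 !cjE Kc; field; rewrite dl dl' g0 gb0.
have h2 : g * z2 + g^bar * z2^bar = c.
  by rewrite -[RHS]h1 /z2 !cjE; field; rewrite ?dl ?dl' ?g0 ?gb0.
have f1 := tr _ h1; have f2 := tr _ h2.
have Kr : inK q (g' / g).
  rewrite inKE; apply/eqP; apply: (mulfI dl).
  apply/eqP; rewrite -subr_eq0; apply/eqP.
  transitivity (- ((g' * z2 + g'^bar * z2^bar) - (g' * z1 + g'^bar * z1^bar))).
    by rewrite /z2 !cjE; field; rewrite ?dl ?dl' ?g0 ?gb0.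
  by rewrite f1 f2 subrr oppr0.
split=> //; rewrite -f1 -h1 mulrDr.
have -> : g'^bar = g' / g * g^bar by rewrite -(inKP Kr) cjM cjV mulfVK.
by field.
Qed.

Definition reps := 1 |: [set w + k | k in subK F q].

Lemma card_reps : #|reps| = q.+1.
Proof.
rewrite cardsU1 card_imset; last exact: addrI.
rewrite (card_subK cardF subB).
suff -> : 1 \notin [set w + k | k in subK F q] by [].
apply/imsetP=> -[k]; rewrite inE => Kk e; case/negP: wK.
by rewrite (_ : w = 1 - k) ?(inKD cardF) ?(inKN cardF) // e addrK.
Qed.

Lemma reps_neq0 g : g \in reps -> g != 0.
Proof.
case/setU1P=> [->|/imsetP[k]]; first exact: oner_neq0.
rewrite inE => Kk ->; apply: contraNneq wK => /eqP.
by rewrite addr_eq0 => /eqP->; rewrite (inKN cardF).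
Qed.

Lemma reps_inj g g' : g \in reps -> g' \in reps -> inK q (g' / g) -> g = g'.
Proof.
have notK k : inK q k -> ~ inK q (w + k).
  move=> Kk h; case/negP: wK; rewrite -(addrK k w).
  by rewrite (inKD cardF) ?(inKN cardF).
move=> Dg Dg'; have g0 := reps_neq0 Dg.
case/setU1P: Dg g0 => [->|/imsetP[k]]; case/setU1P: Dg' => [->|/imsetP[k']] //.
- by rewrite inE => Kk' -> _; rewrite divr1 => /(notK _ Kk').
- by rewrite inE => Kk -> _; rewrite mul1r (inKV q) => /(notK _ Kk).
rewrite !inE => Kk' -> Kk -> g0; set r := _ / _ => Kr.
have er : w + k' = r * (w + k) by rewrite /r mulfVK.
have [r1|r1] := eqVneq r 1; first by rewrite er r1 mul1r.
have r1' : r - 1 != 0 by rewrite subr_eq0.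
(* For r other than 1, the relation w + k' = r (w + k) could be solved for w inside K. *)
case/negP: wK; rewrite (_ : w = (k' - r * k) / (r - 1)).
  by rewrite inKM // ?(inKV q) (inKD cardF) // (inKN cardF) // inKM.
apply: (mulIf r1'); rewrite mulfVK //.
by transitivity (r * (w + k) - w - r * k); [ring | rewrite -er; ring].
Qed.

Lemma pencil_reps g : g != 0 -> exists2 g', g' \in reps & Pi g 0 = Pi g' 0.
Proof.
move=> g0; have [x [y [Kx Ky eg]]] := decompose_over_K cardF wK g.
have [y0|y0] := eqVneq y 0.
  exists 1; first exact: setU11.
  have gx : g = x by rewrite eg y0 mulr0 addr0.
  by rewrite gx in g0 *; rewrite -(herm_pencilZ 1 0 g0 Kx) mulr0 mulr1.
exists (w + x / y); first by apply/setU1r/imset_f; rewrite inE inKM ?(inKV q).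
rewrite -(herm_pencilZ (w + x / y) 0 y0 Ky) mulr0; congr herm_pencil.
by rewrite eg; field.
Qed.

End Intersections.

Theorem theorem2p8 (F : finFieldType) (q : nat) (linf : line F) (B : {set point F})
    (T P : point F) :
  #|F| = (q ^ 2)%N ->
  baer_subplane q B ->
  B :&: pts linf = [set T] ->
  on P linf -> P != T ->
  [/\ (exists! m : line F, line_of q B m && on P m),
      (forall Pi : {set point F}, linf_baer_pencil q linf P Pi ->
          typeI q B T Pi \/ typeII q B P T Pi),
      #|[set Pi : {set point F} | linf_baer_pencil q linf P Pi && typeI q B T Pi]| = (q ^ 2 - 1)%N,
      #|[set Pi : {set point F} | linf_baer_pencil q linf P Pi && typeII q B P T Pi]| = q.+1 &
      (forall n : line F, line_of q B n -> on T n ->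
          exists! Pi : {set point F}, linf_baer_pencil q linf P Pi && typeII_with q B P n Pi)].
Proof.
move=> cardF subB Binf Plinf PT.
have PB : P \notin B.
  by apply: contra PT => PB; rewrite -in_set1 -Binf in_setI PB mem_pts.
have [M [w [fM wK eP eT el]]] := normal_frame cardF subB Binf Plinf PT.
have uM := ((baer_frameP q M B).1 fM).1.
rewrite eP in PB; rewrite {Plinf PT Binf}eP {}eT {}el {P T linf}.
have pencilP := linf_baer_pencilP cardF uM wK.
have K0 := inK0 cardF; have K1 := inK1 F q.
have typeII_coeff g c : g != 0 -> inK q c ->
    typeII q B (pt3 M 1 w 0) (pt3 M 0 0 1) (herm_pencil q M w g c) -> c = 0.
  move=> g0 Kc /existsP[n /and3P[ln Tn]].
  have [g' g0' ->] := lineT cardF fM wK ln Tn.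
  by case/(typeII_with_coeffs cardF subB fM wK PB g0 g0' Kc).
split.
- exists (ln3 M 0 0 1); split; first exact: m0_line.
  exact: m0_uniq.
- move=> Pi /pencilP[g [c [g0 Kc ->]]].
  have [->|c0] := eqVneq c 0; first by right; apply: pencil_typeII.
  by left; apply: pencil_typeI.
- have -> : [set Pi | linf_baer_pencil q (ln3 M w (-1) 0) (pt3 M 1 w 0) Pi &&
      typeI q B (pt3 M 0 0 1) Pi] =
      [set herm_pencil q M w g 1 | g in [set~ 0]].
    apply/setP=> Pi; rewrite inE; apply/andP/imsetP.
      case=> /pencilP[g [c [g0 Kc ->]]] /andP[hC _].
      (* With c = 0 the intersection contains a full line of [B], which no conic does. *)
      have c0 : c != 0.
        apply: contraTneq hC => ->.
        exact: (typeII_with_not_conic cardF (pencil_typeII_with cardF subB fM wK g0)).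
      exists (c^-1 * g); first by rewrite in_setC1 mulf_neq0 ?invr_eq0.
      by rewrite -(herm_pencilZ M w g c (invr_neq0 c0)) ?(inKV q) ?mulVf.
    case=> g; rewrite in_setC1 => g0 ->; split; first by apply/pencilP; exists g, 1.
    by apply: pencil_typeI; rewrite ?oner_neq0.
  rewrite card_in_imset => [|g g' + _].
    by rewrite cardsC1 cardF subn1.
  rewrite in_setC1 => g0 /(herm_pencil_inj cardF fM wK g0 K1)[_].
  by rewrite mulr1 => /(congr1 ( *%R^~ g)); rewrite mul1r mulfVK.
- have -> : [set Pi | linf_baer_pencil q (ln3 M w (-1) 0) (pt3 M 1 w 0) Pi &&
      typeII q B (pt3 M 1 w 0) (pt3 M 0 0 1) Pi] =
      [set herm_pencil q M w g 0 | g in reps q w].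
    apply/setP=> Pi; rewrite inE; apply/andP/imsetP.
      case=> /pencilP[g [c [g0 Kc ->]]] /typeII_coeff -> //.
      have [g' Dg' ->] := pencil_reps M cardF wK g0.
      by exists g'.
    case=> g /(reps_neq0 cardF wK) g0 ->; split; first by apply/pencilP; exists g, 0.
    exact: pencil_typeII.
  rewrite card_in_imset => [|g g' Dg Dg']; first exact: card_reps subB wK.
  case/(herm_pencil_inj cardF fM wK (reps_neq0 cardF wK Dg) K0) => + _.
  exact: reps_inj Dg Dg'.
move=> n ln Tn; have [g g0 en] := lineT cardF fM wK ln Tn.
exists (herm_pencil q M w g 0); split.
  apply/andP; split; first by apply/pencilP; exists g, 0.
  by rewrite en; apply: pencil_typeII_with.
move=> Pi /andP[/pencilP[g' [c [g0' Kc ->]]]]; rewrite en.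
case/(typeII_with_coeffs cardF subB fM wK PB g0' g0 Kc) => -> Kr.
have r0 : g' / g != 0 by rewrite mulf_neq0 ?invr_eq0.
by rewrite -(herm_pencilZ M w g 0 r0 Kr) mulr0 mulfVK.
Qed.
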